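(* Let $\frac13<\gamma<1$, let $\delta(\varepsilon)=\varepsilon^{\frac{1-\gamma}{1+\gamma}}$ and let $1\le n<\infty$ be an integer. (1) Let $x_0\neq0$ and let $t_\varepsilon$ be the unique time such that $d_{1,\varepsilon}(t_\varepsilon,x_0)=1$. Then for small enough $\varepsilon$ one has $d_{n,\varepsilon}(t_\varepsilon,x_0)\approx1$ with implied constant independent of $\varepsilon$. Furthermore, there is a constant $C=C(\gamma)\ge1$ such that for small enough $\varepsilon$ $$\frac{\log(1/C)}{\lambda_1}\varepsilon^{\frac{1-\gamma}{1+\gamma}}+\frac{|x_0|^{1-\gamma}}{1-\gamma}\le t_\varepsilon\le\frac{\log(C)}{\lambda_1}\varepsilon^{\frac{1-\gamma}{1+\gamma}}+\frac{|x_0|^{1-\gamma}}{1-\gamma}.$$ (2) Let $x_0=0$ and $E_n:=\{1\le j\le n:\ \psi_j(0)\neq0\}$. If $E_n=\emptyset$, then $d_{n,\varepsilon}(t,0)=0$ for all $t\ge0$. Otherwise, let $m:=\max E_n$ and define $t_\varepsilon$ by $$e^{-2\lambda_m\varepsilon^{\frac{\gamma-1}{1+\gamma}}t_\varepsilon}\left(\int_{\mathbb R}\varrho_{\varepsilon,0}(x)\psi_{m,\varepsilon}(x)\,dx\right)^2=1.$$ Then, for $\varepsilon$ sufficiently small, $d_{n,\varepsilon}(t_\varepsilon,0)\approx1$ with implied constant independent of $\varepsilon$. In addition, there is a constant $C\ge1$, independent of $\varepsilon$, such that for small enough $\varepsilon$ $$\frac{\varepsilon^{\frac{1-\gamma}{1+\gamma}}}{\lambda_m}\left(\frac{\gamma(1-\gamma)}{1+\gamma}\log(\varepsilon)-\log(C)\right)+\frac{1}{1-\gamma}\varepsilon^{\frac{(\gamma-1)^2}{\gamma+1}}\le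 t_\varepsilon\le\frac{\varepsilon^{\frac{1-\gamma}{1+\gamma}}}{\lambda_m}\left(\frac{\gamma(1-\gamma)}{1+\gamma}\log(\varepsilon)+\log(C)\right)+\frac{1}{1-\gamma}\varepsilon^{\frac{(\gamma-1)^2}{\gamma+1}}.$$
   Context: $V(x)=\frac{1}{\gamma+1}|x|^{\gamma+1}$; for $\varepsilon\in(0,1]$, $\mathcal L_\varepsilon u=\varepsilon u''-V'u'$ and $\varrho_{\varepsilon,\infty}(x)=C_\varepsilon e^{-V(x)/\varepsilon}$ with $C_\varepsilon$ making it a probability density. $-\mathcal L_\varepsilon$ on $L^2(\varrho_{\varepsilon,\infty}dx)$ has discrete simple spectrum $0=\lambda_{0,\varepsilon}<\lambda_{1,\varepsilon}<\cdots$ with eigenfunctions $\psi_{0,\varepsilon}=1,\psi_{1,\varepsilon},\dots$ forming an orthonormal basis; for $\varepsilon=1$ write $\lambda_k,\psi_k$. One has $\lambda_{k,\varepsilon}=\lambda_k\varepsilon^{\frac{\gamma-1}{\gamma+1}}$. The initial density is $\varrho_{\varepsilon,0}=\frac{1}{2\delta(\varepsilon)}\mathbf 1_{(x_0-\delta(\varepsilon),x_0+\delta(\varepsilon))}$. With $\varrho_{\varepsilon,t}$ the solution of $\partial_t\varrho=(\varrho V'+\varepsilon\varrho')'$ started from $\varrho_{\varepsilon,0}$, the truncated $\chi^2$-distance $d_{n,\varepsilon}(t,x_0)$ is the $L^2(\varrho_{\varepsilon,\infty}dx)$-norm of $\Pi_{n,\varepsilon}[\varrho_{\varepsilon,t}/\varrho_{\varepsilon,\infty}]-1$,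 where $\Pi_{n,\varepsilon}$ is the orthogonal projection onto the span of $\psi_{0,\varepsilon},\dots,\psi_{n,\varepsilon}$; equivalently $$d_{n,\varepsilon}(t,x_0)=\left(\sum_{k=1}^ne^{-2\lambda_{k,\varepsilon}t}\left(\int_{\mathbb R}\varrho_{\varepsilon,0}(x)\psi_{k,\varepsilon}(x)\,dx\right)^2\right)^{1/2},\quad t\ge0.$$ For positive quantities, $a\approx b$ means $\frac1Cb\le a\le Cb$ for a constant $C\ge1$ (the implied constant). The notation $C=C(\gamma)$ means that the constant depends on $\gamma$.
   Formalization: In (1) the constant C=C(γ) in the bounds on t_ε is allowed to depend also on the fixed x_0 (not on n or ε); a C depending on γ alone is impossible, since averaging over the initial window gives a factor sinh(s)/s with s=λ_1|x_0|^{-γ}, unbounded as x_0→0. *)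

(* Defs.v *)
From HB Require Import structures.
From mathcomp Require Import all_boot all_order all_algebra.
From mathcomp Require Import all_classical all_reals all_analysis.

Set Implicit Arguments.
Unset Strict Implicit.
Unset Printing Implicit Defensive.

Import Order.TTheory GRing.Theory Num.Theory.
Import numFieldNormedType.Exports.

Local Open Scope classical_set_scope.
Local Open Scope ring_scope.

Section Diffusion.
Context {R : realType}.
Notation mu := (@lebesgue_measure R).

Definition potential (gamma x : R) : R :=
  (gamma + 1)^-1 * `|x| `^ (gamma + 1).

Definition generator (gamma eps : R) (u : R -> R) (x : R) : R :=
  eps * (u^`(2))%classic x - ((potential gamma)^`())%classic x * (u^`())%classic x.

Definition gibbs_weight (gamma eps x : R) : R :=
  expR (- potential gamma x / eps).

Definition gibbs (gamma eps x : R) : R :=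
  (\int[mu]_y gibbs_weight gamma eps y)^-1 * gibbs_weight gamma eps x.

Definition sqintegrable (gamma eps : R) (f : R -> R) : Prop :=
  measurable_fun setT f /\
  mu.-integrable setT (fun x => (f x ^+ 2 * gibbs gamma eps x)%:E).

Definition inner (gamma eps : R) (f g : R -> R) : R :=
  \int[mu]_x (f x * g x * gibbs gamma eps x).

Definition L2norm (gamma eps : R) (f : R -> R) : R :=
  Num.sqrt (inner gamma eps f f).

(* V' is continuous for gamma > 0, so the elements of an eigenspace of the
   self-adjoint operator are represented by classical solutions; conversely a
   classical solution in the weighted L2 space lies in the domain of the
   operator, both infinities being in the limit-point case. *)
Definition eigenfunction (gamma eps l : R) (u : R -> R) : Prop :=
  [/\ sqintegrable gamma eps u,
      exists x, u x != 0,
      forall x, derivable u x 1,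
      forall x, derivable (u^`())%classic x 1 &
      forall x, - generator gamma eps u x = l * u x].

Definition orthonormal_basis (gamma eps : R) (psi : nat -> R -> R) : Prop :=
  [/\ forall k, sqintegrable gamma eps (psi k),
      forall j k, inner gamma eps (psi j) (psi k) = (j == k)%:R &
      forall f, sqintegrable gamma eps f ->
        (fun n => L2norm gamma eps (fun x =>
           f x - \sum_(0 <= k < n) inner gamma eps f (psi k) * psi k x))
        @ \oo --> (0 : R)].

(* The divergence of l (no finite accumulation point) is the discreteness of the
   spectrum; the next-to-last clause says that the l_k exhaust the eigenvalues and that each
   of them is simple. *)
Definition spectral_system (gamma eps : R) (l : nat -> R)
    (psi : nat -> R -> R) : Prop :=
  [/\ [/\ l 0%N = 0, forall x, psi 0%N x = 1 &
          {homo l : i j / (i < j)%N >-> i < j}],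
      l @ \oo --> +oo,
      forall k, eigenfunction gamma eps (l k) (psi k),
      forall a u, eigenfunction gamma eps a u ->
        exists k, a = l k /\ exists c, forall x, u x = c * psi k x &
      orthonormal_basis gamma eps psi].

Definition radius (gamma eps : R) : R :=
  eps `^ ((1 - gamma) / (1 + gamma)).

Definition initial_density (gamma eps x0 x : R) : R :=
  (2 * radius gamma eps)^-1 *
  \1_(`]x0 - radius gamma eps, x0 + radius gamma eps[%classic) x.

Definition initial_coef (gamma eps x0 : R) (f : R -> R) : R :=
  \int[mu]_x (initial_density gamma eps x0 x * f x).

(* Solving the Fokker-Planck equation multiplies the k-th coefficient of
   rho_t / rho_infty in the basis psi by exp (- l_k t); the term k = 0 is
   cancelled by the constant 1. *)
Definition chi2_dist (gamma eps : R) (l : nat -> R) (psi : nat -> R -> R)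
    (n : nat) (t x0 : R) : R :=
  Num.sqrt (\sum_(1 <= k < n.+1)
    expR (- 2 * l k * t) * initial_coef gamma eps x0 (psi k) ^+ 2).

Definition nonvanishing_indices (psi : nat -> R -> R) (n : nat) : seq nat :=
  [seq j <- index_iota 1 n.+1 | psi j 0 != 0].

End Diffusion.

(* Main.v *)
Require Import Defs.
From HB Require Import structures.
From mathcomp Require Import all_boot all_order all_algebra.
From mathcomp Require Import all_classical all_reals all_analysis.
From mathcomp Require Import measurable_realfun.
From mathcomp Require Import ring lra.

Set Implicit Arguments.
Unset Strict Implicit.
Unset Printing Implicit Defensive.

Import Order.TTheory GRing.Theory Num.Theory.
Import numFieldNormedType.Exports.

Local Open Scope classical_set_scope.
Local Open Scope ring_scope.

(** The change of variables [x = eps ^ (1 / (1 + gamma)) y] brings the noise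
    level to 1. Since the spectrum is simple and discrete, the eigenvalues at
    noise [eps] are [l_k eps ^ ((gamma - 1) / (1 + gamma))] and the
    eigenfunctions are, up to sign, those of noise 1 in the variable [y]
    ([spectral_system_scale]). The coefficient of the initial density becomes
    the mean of a fixed eigenfunction [u] over a window of half-width
    [b ^ gamma] centred at [b x0], where [b = eps ^ (- 1 / (1 + gamma))] tends
    to infinity. Everything then rests on the growth of [u] at infinity.

    The equation [u'' - x ^ gamma u' = - l u] has solutions of two kinds at
    infinity: the dominant ones grow roughly like
    [exp (x ^ (gamma + 1) / (gamma + 1))] and are not square integrable for the
    Gibbs density; the recessive ones are governed by [x ^ gamma u' = l u], that is
    [u ~ exp (l x ^ (1 - gamma) / (1 - gamma))]. Comparison in the Riccati
    equation for [u' / u], together with a limit-point argument that excludes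
    the dominant behaviour, shows that an eigenfunction is comparable to this
    exponential ([eigen_ode_asymptotics]). The next term in [u' / u] is of order
    [x ^ (- 3 gamma)], which is integrable precisely when [gamma > 1/3].

    If [x0 <> 0] the window is so narrow that the exponential varies on it by
    a bounded factor only, and the k-th coefficient is of order
    [exp (l_k Z)] with [Z = (b |x0|) ^ (1 - gamma) / (1 - gamma)]
    ([window_mean_away]). All modes are then reduced to order 1 at the same
    time, which is [|x0| ^ (1 - gamma) / (1 - gamma)] up to the order of the
    radius. If [x0 = 0] every eigenfunction is even or odd, an odd one
    contributes nothing, and an even one has a mean of order
    [h ^ (gamma - 1) exp (l_k Z)], with [h = b ^ gamma] and
    [Z = h ^ (1 - gamma) / (1 - gamma)] ([window_mean_center]). Because of the
    small prefactor, the last mode to relax is the one with the largest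
    eigenvalue. *)

(** * Derivatives and powers *)

Section PointwiseDerivatives.
Context {R : realType}.
Implicit Types (f g : R -> R) (x k df dg : R).

Lemma is_derive_add f g x df dg : is_derive x 1 f df -> is_derive x 1 g dg ->
  is_derive x 1 (fun y => f y + g y) (df + dg).
Proof. by move=> fx gx; exact: is_deriveD. Qed.

Lemma is_derive_sub f g x df dg : is_derive x 1 f df -> is_derive x 1 g dg ->
  is_derive x 1 (fun y => f y - g y) (df - dg).
Proof. by move=> fx gx; exact: is_deriveB. Qed.

Lemma is_derive_opp f x df : is_derive x 1 f df ->
  is_derive x 1 (fun y => - f y) (- df).
Proof. by move=> fx; exact: is_deriveN. Qed.

Lemma is_derive_mull k f x df : is_derive x 1 f df ->
  is_derive x 1 (fun y => k * f y) (k * df).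
Proof. by move=> fx; exact: is_deriveZ. Qed.

Lemma is_derive_mul f g x df dg : is_derive x 1 f df -> is_derive x 1 g dg ->
  is_derive x 1 (fun y => f y * g y) (df * g x + f x * dg).
Proof.
move=> fx gx; have := @is_deriveM _ _ f g x 1 df dg fx gx.
by rewrite /GRing.scale/= addrC [g x * _]mulrC.
Qed.

Lemma is_derive_expR_comp f x df : is_derive x 1 f df ->
  is_derive x 1 (fun y => expR (f y)) (df * expR (f x)).
Proof.
by move=> fx; rewrite mulrC; exact: (@is_derive1_comp _ expR f).
Qed.

Lemma is_derive_inv f x df : f x != 0 -> is_derive x 1 f df ->
  is_derive x 1 (fun y => (f y)^-1) (- df / f x ^+ 2).
Proof.
move=> fx0 fx; have := is_deriveV fx0 fx; rewrite /GRing.scale/=.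
by rewrite mulNr mulrC -mulNr.
Qed.

Lemma is_derive_scale_arg f k x df : is_derive (k * x) 1 f df ->
  is_derive x 1 (fun y => f (k * y)) (k * df).
Proof.
move=> fx; rewrite mulrC; apply: (@is_derive1_comp _ f (fun y => k * y) x df k fx).
by have := @is_derive_mull k id x 1 (is_derive_id _ _); rewrite mulr1.
Qed.

End PointwiseDerivatives.

Lemma is_derive_continuous (R : realType) (f : R -> R) (x d : R) :
  is_derive x 1 f d -> {for x, continuous f}.
Proof. by move=> [df _]; apply/differentiable_continuous/derivable1_diffP. Qed.

Lemma is_derive_MVT (R : realType) (f df : R -> R) (a b : R) :
  a < b -> (forall x, a <= x <= b -> is_derive x 1 f (df x)) ->
  exists2 c, a < c < b & f b - f a = df c * (b - a).
Proof.
move=> ab fd.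
have [||c cab E] := @MVT R f df a b ab.
- by move=> x; rewrite in_itv/= => /andP[ax xb]; apply: fd; rewrite !ltW.
- apply: derivable_within_continuous => x; rewrite in_itv/= => axb.
  by have [] := fd x axb.
- by exists c => //; move: cab; rewrite in_itv.
Qed.

Lemma is_derive_ndecr (R : realType) (f df : R -> R) (a : R) :
  (forall x, a <= x -> is_derive x 1 f (df x)) ->
  (forall x, a <= x -> 0 <= df x) ->
  forall x y, a <= x -> x <= y -> f x <= f y.
Proof.
move=> fd fp x y ax; rewrite le_eqVlt => /predU1P[->//|xy].
have [|c /andP[xc cy] E] := @is_derive_MVT _ f df x y xy.
  by move=> z /andP[xz _]; apply: fd; exact: le_trans xz.
rewrite -subr_ge0 E mulr_ge0 ?subr_ge0 ?(ltW xy)// fp//.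
by rewrite (le_trans ax)// ltW.
Qed.

Lemma is_derive_nincr (R : realType) (f df : R -> R) (a : R) :
  (forall x, a <= x -> is_derive x 1 f (df x)) ->
  (forall x, a <= x -> df x <= 0) ->
  forall x y, a <= x -> x <= y -> f y <= f x.
Proof.
move=> fd fp x y ax xy.
have := @is_derive_ndecr _ (fun x => - f x) (fun x => - df x) a _ _ x y ax xy.
rewrite lerN2; apply => z az; last by rewrite oppr_ge0 fp.
by have := fd z az => fz; apply: is_deriveN.
Qed.

Lemma sqr_eq1_norm (R : realType) (s : R) : s ^+ 2 = 1 -> `|s| = 1.
Proof.
by move=> s2; apply/eqP; rewrite -sqrp_eq1// real_normK ?num_real// s2.
Qed.

Lemma powR_eventually_small (R : realType) (p c : R) : 0 < p -> 0 < c ->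
  exists2 X, 1 <= X & forall x, X <= x -> x `^ (- p) <= c.
Proof.
move=> p0 c0; exists (Num.max 1 (c `^ (- p^-1))); first by rewrite le_max lexx.
move=> x; rewrite ge_max => /andP[x1 cx].
have x0 : 0 < x by rewrite (lt_le_trans _ x1).
have -> : c = (c `^ (- p^-1)) `^ (- p).
  by rewrite -powRrM mulrNN mulVf ?gt_eqF// powRr1// ltW.
rewrite (powRN x) (powRN (c `^ _)) lef_pV2 ?posrE ?powR_gt0//.
by rewrite ge0_ler_powR ?nnegrE ?powR_ge0 ?(ltW p0) ?(ltW x0)//.
Qed.

Lemma is_derive_potential (R : realType) (gamma x : R) : 0 < gamma ->
  is_derive x 1 (potential gamma) (Num.sg x * `|x| `^ gamma).
Proof.
move=> g0; have g1 : 0 < gamma + 1 by rewrite addr_gt0.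
have pos (y : R) : 0 < y ->
    is_derive y 1 (fun z : R => (gamma + 1)^-1 * z `^ (gamma + 1)) (y `^ gamma).
  move=> y0; have := is_derive_mull (gamma + 1)^-1 (is_derive1_powR (gamma + 1) y0).
  by rewrite addrK mulrA mulVf ?mul1r// gt_eqF.
have [x0|x0|x0] := ltgtP x 0.
- rewrite ltr0_sg// ltr0_norm// mulN1r.
  apply: (@near_eq_is_derive _ _ _
    (fun y => (gamma + 1)^-1 * (- y) `^ (gamma + 1))).
    near=> y; rewrite /potential ltr0_norm//.
    by near: y; exact: lt_nbhsl.
  rewrite -mulN1r; have h := pos (-1 * x) ltac:(by rewrite mulN1r oppr_gt0).
  rewrite -[in (_ * _)](mulN1r x); have := is_derive_scale_arg h.
  by under eq_fun do rewrite mulN1r.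
- rewrite gtr0_sg// gtr0_norm// mul1r.
  apply: (@near_eq_is_derive _ _ _
    (fun y => (gamma + 1)^-1 * y `^ (gamma + 1))).
    near=> y; rewrite /potential gtr0_norm//.
    by near: y; exact: lt_nbhsr.
  exact: pos.
- rewrite x0 sgr0 mul0r; apply/is_derive1_caratheodory.
  exists (fun z => Num.sg z * ((gamma + 1)^-1 * `|z| `^ gamma)); split.
  (* At 0 the slope function is z |-> sg z * |z|^gamma / (gamma + 1). *)
  + move=> z; rewrite /potential normr0 powR0 ?gt_eqF// mulr0 !subr0.
    have [->|z0] := eqVneq z 0; first by rewrite normr0 powR0 ?gt_eqF// !mulr0.
    rewrite powRD; last by rewrite normr_eq0 z0 implybT.
    transitivity ((gamma + 1)^-1 * `|z| `^ gamma * (Num.sg z * z)); last by ring.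
    by rewrite -normrEsg powRr1// mulrA.
  + rewrite /prop_for/continuous_at/= sgr0 mul0r.
    apply/cvgr0Pnorm_lt => e e0.
    have d0 : 0 < (e * (gamma + 1)) `^ gamma^-1 by rewrite powR_gt0// mulr_gt0.
    near=> z.
    have : `|z| < (e * (gamma + 1)) `^ gamma^-1.
      near: z; exact: (@nbhs0_lt R R).
    move/(@gt0_ltr_powR _ gamma g0 _ _ (normr_ge0 _) (powR_ge0 _ _)).
    rewrite /= -powRrM mulVf ?gt_eqF// powRr1 ?mulr_ge0 ?ltW// => H.
    rewrite !normrM (ger0_norm (powR_ge0 _ _)).
    rewrite (@ger0_norm _ (gamma + 1)^-1) ?invr_ge0 ?ltW//.
    rewrite normr_sg; case: (z != 0); last by rewrite mul0r.
    by rewrite mul1r mulrC ltr_pdivrMr.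
  + by rewrite sgr0 mul0r.
Unshelve. all: by end_near. Qed.

(** * Second-order equations on a half-line *)

Section SecondOrderOnHalfLine.
Context {R : realType}.
Implicit Types (u v p V G beta B : R -> R) (a lam M : R).

(** The limit-point alternative, free of any asymptotic expansion: as long as
    [T > 0], [T ^+ 2 <= g * tau] yields
    [(G - 1/T)' = g + tau / T ^+ 2 >= g + 1/g >= 2],
    so [G - 1/T] grows linearly. This is impossible when [G], a primitive of
    [g], is bounded above. *)
Lemma limit_point_growth (G g T tau : R -> R) a M :
  (forall x, a <= x -> is_derive x 1 G (g x)) ->
  (forall x, a <= x -> is_derive x 1 T (tau x)) ->
  (forall x, a <= x -> 0 <= tau x) -> (forall x, a <= x -> 0 <= g x) ->
  (forall x, a <= x -> T x ^+ 2 <= g x * tau x) ->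
  (forall x, a <= x -> G x <= M) -> T a <= 0.
Proof.
move=> Gd Td tau0 g0 Tg GM; rewrite leNgt; apply/negP => Ta.
have Tpos x : a <= x -> 0 < T x.
  by move=> ax; apply: lt_le_trans Ta _; exact: (is_derive_ndecr Td tau0).
pose H x := G x - (T x)^-1.
have Hd x : a <= x -> is_derive x 1 H (g x - - tau x / T x ^+ 2).
  move=> ax; apply: (is_derive_sub (Gd x ax)).
  by apply: is_derive_inv (Td x ax); rewrite gt_eqF// Tpos.
have Hd2 x : a <= x -> is_derive x 1 (fun z => H z - 2 * z)
    (g x - - tau x / T x ^+ 2 - 2 * 1).
  by move=> ax; apply: (is_derive_sub (Hd x ax)).
have Hd2_ge0 x : a <= x -> 0 <= g x - - tau x / T x ^+ 2 - 2 * 1.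
  move=> ax; have T2 : 0 < T x ^+ 2 by rewrite exprn_gt0// Tpos.
  have gt0 : 0 < g x.
    rewrite lt_neqAle g0// andbT; apply/eqP => gx0.
    by have := Tg x ax; rewrite -gx0 mul0r leNgt T2.
  rewrite mulNr opprK.
  have : (g x)^-1 <= tau x / T x ^+ 2.
    by rewrite ler_pdivlMr// mulrC ler_pdivrMr// mulrC Tg.
  have : 2 <= g x + (g x)^-1.
    rewrite -subr_ge0.
    have -> : g x + (g x)^-1 - 2 = (g x - 1) ^+ 2 / g x by field; rewrite gt_eqF.
    by rewrite divr_ge0 ?sqr_ge0 ?ltW.
  lra.
pose b := a + (`|M| + `|H a| + 1).
have ab : a <= b by rewrite lerDl !addr_ge0.
have := is_derive_ndecr Hd2 Hd2_ge0 (lexx a) ab.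
have := GM b ab.
have : H b <= G b by rewrite gerBl invr_ge0 ltW// Tpos.
have := ler_norm M; have := ler_norm (- H a); rewrite normrN.
have := normr_ge0 M; have := normr_ge0 (H a).
rewrite /b; lra.
Qed.

(** The logarithmic derivative [w = v / u] of a solution obeys the Riccati
    equation [w' = p w - lam - w ^+ 2]. A comparison function [beta] leaves the
    residual [F], and [D = v - beta u] compares [w] with [beta] without
    dividing by [u], which may vanish. *)
Section Comparison.
Variables (u v p V beta beta1 B : R -> R) (lam a : R).
Hypothesis ud : forall x, a <= x -> is_derive x 1 u (v x).
Hypothesis vd : forall x, a <= x -> is_derive x 1 v (p x * v x - lam * u x).
Hypothesis Vd : forall x, a <= x -> is_derive x 1 V (p x).
Hypothesis betad : forall x, a <= x -> is_derive x 1 beta (beta1 x).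
Hypothesis Bd : forall x, a <= x -> is_derive x 1 B (beta x).

Let F x := p x * beta x - lam - beta x ^+ 2 - beta1 x.
Let D x := v x - beta x * u x.

Let Dd x : a <= x -> is_derive x 1 D ((p x - beta x) * D x + F x * u x).
Proof.
move=> ax; apply: is_derive_eq.
  apply: is_derive_sub (vd ax) _; exact: is_derive_mul (betad ax) (ud ax).
by rewrite /D /F; ring.
Qed.

(** [T = e^-V u D] satisfies [T' = e^-V (D ^+ 2 + F u ^+ 2) >= 0] and
    [T ^+ 2 <= (e^-V u ^+ 2) T']; were it positive somewhere, the weighted
    square of [u] could not be integrable, by [limit_point_growth]. Bounding
    the product [u * D] avoids choosing a sign for [u]. *)
Lemma recessive_upper (G : R -> R) M :
  (forall x, a <= x -> 0 <= F x) ->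
  (forall x, a <= x -> is_derive x 1 G (u x ^+ 2 * expR (- V x))) ->
  (forall x, a <= x -> G x <= M) ->
  forall x, a <= x -> u x * D x <= 0.
Proof.
move=> F0 Gd GM y ay.
pose T x := expR (- V x) * (u x * D x).
pose tau x := expR (- V x) * (D x ^+ 2 + F x * u x ^+ 2).
have tau_ge0 x : y <= x -> 0 <= tau x.
  move=> yx; rewrite mulr_ge0 ?expR_ge0// addr_ge0 ?sqr_ge0//.
  by rewrite mulr_ge0 ?sqr_ge0// F0// (le_trans ay).
suff : T y <= 0 by rewrite /T pmulr_rle0// expR_gt0.
apply: (@limit_point_growth G (fun x => u x ^+ 2 * expR (- V x)) T tau y M) => //.
- by move=> x yx; apply: Gd; exact: le_trans yx.
- move=> x yx; have ax := le_trans ay yx.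
  apply: is_derive_eq.
    apply: is_derive_mul; first exact: is_derive_expR_comp (is_derive_opp (Vd ax)).
    exact: is_derive_mul (ud ax) (Dd ax).
  by rewrite /tau /D/=; ring.
- by move=> x _; rewrite mulr_ge0 ?sqr_ge0 ?expR_ge0.
- move=> x yx; have ax := le_trans ay yx; rewrite /T /tau -subr_ge0.
  rewrite [leRHS](_ : _ = expR (- V x) ^+ 2 * (F x * (u x ^+ 2) ^+ 2)).
    by apply: mulr_ge0; [exact: sqr_ge0|apply: mulr_ge0; [exact: F0|exact: sqr_ge0]].
  by ring.
- by move=> x yx; apply: GM; exact: le_trans yx.
Qed.

(** The square makes the monotonicity independent of the sign of [u]; it is
    what excludes zeros: past a zero, [u] would vanish identically. *)
Lemma recessive_square_nincr :
  (forall x, a <= x -> u x * D x <= 0) ->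
  forall x y, a <= x -> x <= y ->
    (u y * expR (- B y)) ^+ 2 <= (u x * expR (- B x)) ^+ 2.
Proof.
move=> uD.
pose h x := u x * expR (- B x).
have hd x : a <= x -> is_derive x 1 h (D x * expR (- B x)).
  move=> ax; apply: is_derive_eq.
    apply: (is_derive_mul (ud ax)).
    exact: is_derive_expR_comp (is_derive_opp (Bd ax)).
  by rewrite /D/=; ring.
apply: (@is_derive_nincr _ (fun x => h x ^+ 2)
  (fun x => 2 * (u x * D x) * expR (- B x) ^+ 2)).
  move=> x ax; under eq_fun do rewrite expr2.
  apply: is_derive_eq; first exact: is_derive_mul (hd x ax) (hd x ax).
  by rewrite /h/=; ring.
move=> x ax; rewrite mulr_le0_ge0 ?sqr_ge0// pmulr_rle0//.
exact: uD.
Qed.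

(** [m = e^(B - V) D] is nonincreasing. If it becomes negative then
    [(u e^-B)' = m e^(V - 2 B)] stays below a negative constant, and [u] has
    to change sign. *)
Lemma positive_solution_lower :
  (forall x, a <= x -> F x <= 0) ->
  (forall x, a <= x -> 0 <= V x - 2 * B x) ->
  (forall x, a <= x -> 0 < u x) ->
  forall x, a <= x -> 0 <= D x.
Proof.
move=> F0 VB upos y ay; rewrite leNgt; apply/negP => Dy.
pose m x := expR (B x - V x) * D x.
have md x : a <= x -> is_derive x 1 m (expR (B x - V x) * (F x * u x)).
  move=> ax; apply: is_derive_eq.
    apply: is_derive_mul (Dd ax).
    exact: is_derive_expR_comp (is_derive_sub (Bd ax) (Vd ax)).
  by rewrite /=; ring.
have m_nincr x : y <= x -> m x <= m y.
  move=> yx; apply: (is_derive_nincr md _ ay yx) => z az.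
  rewrite mulr_ge0_le0 ?expR_ge0// mulr_le0_ge0 ?F0// ltW//; exact: upos.
have my : m y < 0 by rewrite /m pmulr_rlt0 ?expR_gt0.
pose h x := u x * expR (- B x) - m y * x.
have hd x : a <= x -> is_derive x 1 h (D x * expR (- B x) - m y * 1).
  move=> ax; apply: (is_derive_eq (is_derive_sub
    (is_derive_mul (ud ax) (is_derive_expR_comp (is_derive_opp (Bd ax))))
    (is_derive_mull (m y) (is_derive_id x 1)))).
  by rewrite /D/=; ring.
have h_nincr x : y <= x -> h x <= h y.
  move=> yx; apply: (is_derive_nincr (a := y) _ _ (lexx y) yx) => z yz.
    by apply: hd; exact: le_trans yz.
  have az := le_trans ay yz.
  have -> : D z * expR (- B z) = m z * expR (V z - 2 * B z).
    rewrite /m mulrAC -expRD [RHS]mulrC; congr (_ * expR _); ring.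
  rewrite mulr1 subr_le0; apply: le_trans (m_nincr z yz).
  rewrite -subr_ge0 -{1}[m z]mulr1 -mulrBr mulr_le0//.
    by rewrite (le_trans (m_nincr z yz))// ltW.
  by rewrite subr_le0 -[X in X <= _]expR0 ler_expR VB.
pose x := y + `|h y + m y * y| / (- m y).
have yx : y <= x by rewrite lerDl divr_ge0// oppr_ge0 ltW.
have := h_nincr x yx; rewrite {1}/h.
have : 0 < u x * expR (- B x) by rewrite mulr_gt0 ?expR_gt0// upos// (le_trans ay).
have : - (m y * x) = `|h y + m y * y| - m y * y.
  by rewrite /x; field; rewrite lt_eqF.
have := ler_norm (h y + m y * y).
by lra.
Qed.

End Comparison.

End SecondOrderOnHalfLine.

(** * The eigenvalue equation *)

Lemma nonvanishing_constant_sign (R : realType) (u : R -> R) (a : R) :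
  continuous u -> (forall x, a <= x -> u x != 0) ->
  exists2 s : R, s ^+ 2 = 1 & forall x, a <= x -> 0 < s * u x.
Proof.
move=> uc u0; exists (Num.sg (u a)); first by rewrite sqr_sg u0.
move=> x ax; rewrite ltNge; apply/negP => su.
have ua : 0 < Num.sg (u a) * u a by rewrite -normrEsg normr_gt0 u0.
have [||c] := @IVT R (fun y => Num.sg (u a) * u y) a x 0 ax.
- apply: continuous_subspaceT => y.
  by apply: cvgM; [exact: cvg_cst|exact: uc].
- by rewrite ge_min le_max su (ltW ua) orbT.
rewrite in_itv/= => /andP[ac _] /eqP; rewrite mulf_eq0 sgr_eq0.
by rewrite (negbTE (u0 _ (lexx a))) (negbTE (u0 _ ac)).
Qed.

Section EigenODE.
Context {R : realType}.
Variables (gamma lam : R).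
Hypothesis gamma_gt0 : 0 < gamma.
Implicit Types u v : R -> R.

(** The equation of the eigenfunctions at noise level 1, as a first-order
    system; [sg x * |x| ^ gamma] is the derivative of the potential. *)
Definition eigen_ode u v :=
  (forall x : R, is_derive x 1 u (v x)) /\
  (forall x : R, is_derive x 1 v (Num.sg x * `|x| `^ gamma * v x - lam * u x)).

Lemma eigen_ode_scale k u v :
  eigen_ode u v -> eigen_ode (fun x => k * u x) (fun x => k * v x).
Proof.
move=> [ud vd]; split=> x; first exact: is_derive_mull.
by apply: (is_derive_eq (is_derive_mull k (vd x))); ring.
Qed.

Lemma eigen_ode_reflect u v :
  eigen_ode u v -> eigen_ode (fun x => u (-1 * x)) (fun x => -1 * v (-1 * x)).
Proof.
move=> [ud vd]; split=> x.
  by apply: is_derive_scale_arg; exact: ud.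
apply: (is_derive_eq (is_derive_mull (-1) (is_derive_scale_arg (vd (-1 * x))))).
by rewrite mulN1r sgrN normrN; ring.
Qed.

(** A Gronwall estimate for the energy [u ^+ 2 + v ^+ 2], the drift being
    bounded on every segment. *)
Lemma eigen_ode_zero_right u v a : eigen_ode u v -> u a = 0 -> v a = 0 ->
  forall x, a <= x -> u x = 0.
Proof.
move=> [ud vd] ua va b; rewrite le_eqVlt => /predU1P[<-//|ab].
pose M := (`|a| + `|b|) `^ gamma.
pose K := 1 + `|lam| + 2 * M.
pose p x := Num.sg x * `|x| `^ gamma.
pose e x := (u x * u x + v x * v x) * expR (- (K * x)).
pose de x := (2 * (u x * v x) + 2 * v x * (p x * v x - lam * u x)
   - K * (u x * u x + v x * v x)) * expR (- (K * x)).
have ed x : a <= x <= b -> is_derive x 1 e (de x).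
  move=> _; apply: (is_derive_eq (is_derive_mul
    (is_derive_add (is_derive_mul (ud x) (ud x)) (is_derive_mul (vd x) (vd x)))
    (is_derive_expR_comp (is_derive_opp (is_derive_mull K (is_derive_id x 1)))))).
  by rewrite /de /p/=; ring.
have [c /andP[ac cb] E] := is_derive_MVT ab ed.
have pM : p c <= M.
  have cM : `|c| `^ gamma <= M.
    apply: ge0_ler_powR; rewrite ?nnegrE ?addr_ge0 ?(ltW gamma_gt0)//.
    rewrite ler_norml; apply/andP; split.
      by have := ler_norm (- a); have := normr_ge0 b; rewrite normrN; lra.
    by have := ler_norm b; have := normr_ge0 a; lra.
  apply: le_trans cM; rewrite -[leRHS]mul1r ler_wpM2r ?powR_ge0//.
  by rewrite (le_trans (ler_norm _))// normr_sg; case: (c != 0).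
have dec : de c <= 0.
  rewrite /de mulr_le0_ge0 ?expR_ge0//.
  have M0 : 0 <= M by exact: powR_ge0.
  have l1 : (1 - lam) * (2 * (u c * v c)) <= (1 + `|lam|) * (u c * u c + v c * v c).
    have h1 : `|1 - lam| <= 1 + `|lam|.
      by rewrite (le_trans (ler_normB _ _))// normr1.
    have h2 : `|2 * (u c * v c)| <= u c * u c + v c * v c.
      rewrite ler_norml; apply/andP; split; rewrite -subr_ge0.
        by rewrite [leRHS](_ : _ = (u c + v c) ^+ 2) ?sqr_ge0//; ring.
      by rewrite [leRHS](_ : _ = (u c - v c) ^+ 2) ?sqr_ge0//; ring.
    by rewrite (le_trans (ler_norm _))// normrM ler_pM.
  have l2 : p c * (v c * v c) <= M * (v c * v c).
    by rewrite ler_wpM2r// -expr2 sqr_ge0.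
  have l3 : 0 <= M * (u c * u c) by rewrite mulr_ge0// -expr2 sqr_ge0.
  by rewrite /K; lra.
have ebneg : e b <= 0.
  have : e b - e a <= 0 by rewrite E mulr_le0_ge0// subr_ge0 ltW.
  by rewrite {2}/e ua va mul0r addr0 mul0r subr0.
have : u b * u b + v b * v b <= 0 by move: ebneg; rewrite pmulr_lle0 ?expR_gt0.
have := sqr_ge0 (v b); have := sqr_ge0 (u b); rewrite !expr2 => u2 v2 uv.
have /eqP : u b * u b = 0 by lra.
by rewrite mulf_eq0 orbb => /eqP.
Qed.

(** The drift is odd, so that the points on the left of [a] are reached by
    reflection. *)
Lemma eigen_ode_unique u v a : eigen_ode u v -> u a = 0 -> v a = 0 ->
  forall x, u x = 0.
Proof.
move=> uv ua va x; have [ax|xa] := leP a x.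
  exact: eigen_ode_zero_right uv ua va x ax.
have := @eigen_ode_zero_right _ _ (- a) (eigen_ode_reflect uv).
rewrite !mulN1r !opprK ua va oppr0 => /(_ erefl erefl (- x)).
by rewrite lerN2 mulN1r opprK => -> //; exact: ltW.
Qed.

End EigenODE.

(** * Growth of eigenfunctions at infinity *)

Section Asymptotics.
Context {R : realType}.
Variables (gamma lam : R).
Hypothesis gamma_gt13 : 1 / 3 < gamma.
Hypothesis gamma_lt1 : gamma < 1.
Hypothesis lam_gt0 : 0 < lam.
Implicit Types (u v : R -> R) (x : R).

Let gamma_gt0 : 0 < gamma.
Proof. by move: gamma_gt13; lra. Qed.

(** The primitive of [lam * x ^ (- gamma)], which is [u' / u] to leading order:
    at infinity the term [u''] is negligible in [u'' = x ^ gamma u' - lam u]. *)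
Definition growth_exponent x := lam * (x `^ (1 - gamma) / (1 - gamma)).

(** Besides the two-sided bound on [u], the control of its logarithmic
    derivative is kept: it is needed to integrate [u] up to constants. *)
Definition recessive_growth u v (s X c C : R) := forall x, X <= x ->
  [/\ 0 < s * u x,
      c * expR (growth_exponent x) <= s * u x <= C * expR (growth_exponent x),
      lam * x `^ (- gamma) * (s * u x) <= s * v x &
      s * v x <= (lam * x `^ (- gamma) + 2 * lam ^+ 2 * x `^ (- (3 * gamma)))
                 * (s * u x)].

(** The second term is the primitive of [2 * lam ^+ 2 * x ^ (- 3 gamma)], which
    pays for the square in the Riccati equation. Since [3 * gamma > 1], it is
    negative, so that the correction does not enlarge the upper bound. *)
Let upper_exponent x :=
  growth_exponent x + 2 * lam ^+ 2 / (1 - 3 * gamma) * x `^ (1 - 3 * gamma).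

Lemma is_derive_growth_exponent x : 0 < x ->
  is_derive x 1 growth_exponent (lam * x `^ (- gamma)).
Proof.
move=> x0.
have h := is_derive_mull (lam / (1 - gamma)) (is_derive1_powR (1 - gamma) x0).
rewrite [X in is_derive _ _ X _](_ : _ =
    (fun y => lam / (1 - gamma) * y `^ (1 - gamma))).
  apply: (is_derive_eq h).
  by rewrite addrAC subrr sub0r; field; rewrite subr_eq0 gt_eqF.
by apply/funext => y; rewrite /growth_exponent; ring.
Qed.

Let is_derive_powRN (e x : R) : 0 < x ->
  is_derive x 1 (fun y : R => y `^ (- e)) (- e * (x `^ (- e) * x^-1)).
Proof.
move=> x0; apply: (is_derive_eq (is_derive1_powR (- e) x0)).
rewrite powRD; last by rewrite (gt_eqF x0) implybT.
by rewrite powR_inv1 ?ltW.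
Qed.

Let powRN_mul3 x : 0 < x -> x `^ (- (3 * gamma)) = x `^ (- gamma) ^+ 3.
Proof.
by move=> x0; rewrite -powR_mulrn ?powR_ge0// -powRrM; congr (_ `^ _); ring.
Qed.

Let is_derive_upper_exponent x : 0 < x -> is_derive x 1 upper_exponent
  (lam * x `^ (- gamma) + 2 * lam ^+ 2 * x `^ (- (3 * gamma))).
Proof.
move=> x0; apply: (is_derive_eq (is_derive_add (is_derive_growth_exponent x0)
  (is_derive_mull _ (is_derive1_powR (1 - 3 * gamma) x0)))).
congr (_ + _); rewrite addrAC subrr sub0r; field.
by rewrite subr_eq0 lt_eqF//; move: gamma_gt13; lra.
Qed.

(** The two comparison functions are [alpha = lam x ^ (- gamma)], for which the
    Riccati residual is nonpositive at infinity, and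
    [beta = alpha + 2 lam ^+ 2 x ^ (- 3 gamma)], for which it is nonnegative.
    Integrability enters only through the upper comparison, which also yields
    that [u] has no large zeros. *)
Theorem eigen_ode_asymptotics u v (G : R -> R) M :
  eigen_ode gamma lam u v -> (exists x, u x != 0) ->
  (forall x, is_derive x 1 G (u x ^+ 2 * expR (- potential gamma x))) ->
  (forall x, 1 <= x -> G x <= M) ->
  exists s X c C : R,
    [/\ s ^+ 2 = 1, 1 <= X, 0 < c, 0 < C & recessive_growth u v s X c C].
Proof.
move=> uv [z uz] Gd GM; have [ud vd] := uv.
(* The thresholds make, in this order, the residual of [beta] nonnegative, the
   residual of [alpha] nonpositive, and [V - 2 growth_exponent] nonnegative. *)
have [||X1 X1ge1 hX1] := @powR_eventually_small R (2 * gamma) ((5 * lam)^-1).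
- by rewrite mulr_gt0.
- by rewrite invr_gt0 mulr_gt0.
have [||X2 X2ge1 hX2] := @powR_eventually_small R (1 - gamma) lam => //.
  by rewrite subr_gt0.
have [||X3 X3ge1 hX3] := @powR_eventually_small R (2 * gamma)
    ((1 - gamma) / (2 * lam * (gamma + 1))).
- by rewrite mulr_gt0.
- by rewrite divr_gt0 ?subr_gt0// !mulr_gt0// addr_gt0.
pose X := X1 + X2 + X3.
have Xge1 : 1 <= X by rewrite /X; lra.
have Xpos x : X <= x -> 0 < x by move=> Xx; lra.
have pE x : X <= x -> Num.sg x * `|x| `^ gamma = x `^ gamma.
  by move=> Xx; rewrite gtr0_sg ?Xpos// gtr0_norm ?Xpos// mul1r.
have pyE x : X <= x -> x `^ gamma * x `^ (- gamma) = 1.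
  by move=> Xx; rewrite powRN mulfV// gt_eqF// powR_gt0 ?Xpos.
have y2E x : X <= x -> x `^ (- (2 * gamma)) = x `^ (- gamma) ^+ 2.
  move=> Xx; rewrite -powR_mulrn ?powR_ge0// -powRrM; congr (_ `^ _); ring.
have vd' x : X <= x -> is_derive x 1 v (x `^ gamma * v x - lam * u x).
  by move=> Xx; rewrite -pE.
have Vd x : X <= x -> is_derive x 1 (potential gamma) (x `^ gamma).
  by move=> Xx; rewrite -pE//; exact: is_derive_potential.
pose alpha x := lam * x `^ (- gamma).
pose alpha1 x := lam * (- gamma * (x `^ (- gamma) * x^-1)).
have alphad x : X <= x -> is_derive x 1 alpha (alpha1 x).
  by move=> Xx; exact: is_derive_mull (is_derive_powRN gamma (Xpos x Xx)).
pose beta x := lam * x `^ (- gamma) + 2 * lam ^+ 2 * x `^ (- (3 * gamma)).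
pose beta1 x := alpha1 x +
  2 * lam ^+ 2 * (- (3 * gamma) * (x `^ (- (3 * gamma)) * x^-1)).
have betad x : X <= x -> is_derive x 1 beta (beta1 x).
  move=> Xx; apply: (is_derive_add (alphad x Xx)).
  exact: is_derive_mull (is_derive_powRN (3 * gamma) (Xpos x Xx)).
have Bd x : X <= x -> is_derive x 1 upper_exponent (beta x).
  by move=> Xx; exact: is_derive_upper_exponent (Xpos x Xx).
have Ad x : X <= x -> is_derive x 1 growth_exponent (alpha x).
  by move=> Xx; exact: is_derive_growth_exponent (Xpos x Xx).
have Fbeta x : X <= x -> 0 <= x `^ gamma * beta x - lam - beta x ^+ 2 - beta1 x.
  move=> Xx; have x0 := Xpos x Xx.
  rewrite /beta /beta1 /alpha1 powRN_mul3//.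
  have Y2 : x `^ (- gamma) ^+ 2 <= (5 * lam)^-1.
    by rewrite -y2E// hX1//; move: Xx; rewrite /X; lra.
  have py := pyE x Xx.
  have y0 : 0 < x `^ (- gamma) by rewrite powR_gt0.
  have z0 : 0 < x^-1 by rewrite invr_gt0.
  set y := x `^ (- gamma) in Y2 py y0 *; set p := x `^ gamma in py *.
  set w := x^-1 in z0 *.
  rewrite [leRHS](_ : _ = (p * y - 1) * (lam + 2 * lam ^+ 2 * y ^+ 2)
     + lam ^+ 2 * y ^+ 2 * (2 - (1 + 2 * (lam * y ^+ 2)) ^+ 2)
     + (lam * gamma * (y * w) + 6 * lam ^+ 2 * gamma * (y ^+ 3 * w))); last by ring.
  rewrite py subrr mul0r add0r addr_ge0//; last first.
    by rewrite addr_ge0// !mulr_ge0// ?sqr_ge0 ?exprn_ge0 ?ltW.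
  apply: mulr_ge0; first by rewrite mulr_ge0 ?sqr_ge0.
  rewrite subr_ge0.
  have ly : lam * y ^+ 2 <= 1 / 5.
    rewrite mulrC -ler_pdivlMr// (le_trans Y2)//.
    by rewrite invfM mul1r.
  have ly0 : 0 <= lam * y ^+ 2 by rewrite mulr_ge0 ?sqr_ge0 ?ltW.
  by nra.
have Falpha x : X <= x -> x `^ gamma * alpha x - lam - alpha x ^+ 2 - alpha1 x <= 0.
  move=> Xx; have x0 := Xpos x Xx.
  have py := pyE x Xx; rewrite /alpha /alpha1.
  have -> : x^-1 = x `^ (- gamma) * x `^ (- (1 - gamma)).
    rewrite -powRD; last by rewrite (gt_eqF x0) implybT.
    by rewrite -powR_inv1 ?ltW//; congr (_ `^ _); ring.
  have Y1 : x `^ (- (1 - gamma)) <= lam by rewrite hX2//; move: Xx; rewrite /X; lra.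
  have q0 : 0 <= x `^ (- (1 - gamma)) by exact: powR_ge0.
  set q := x `^ (- (1 - gamma)) in Y1 q0 *.
  set y := x `^ (- gamma) in py *; set p := x `^ gamma in py *.
  rewrite [leLHS](_ : _ = (p * y - 1) * lam
    - (lam * y ^+ 2) * (lam - gamma * q)); last by ring.
  rewrite py subrr mul0r sub0r oppr_le0 mulr_ge0//.
    by rewrite mulr_ge0 ?sqr_ge0 ?ltW.
  by rewrite subr_ge0; move: gamma_gt0 gamma_lt1; nra.
have VA x : X <= x -> 0 <= potential gamma x - 2 * growth_exponent x.
  move=> Xx; have x0 := Xpos x Xx.
  rewrite /potential /growth_exponent gtr0_norm//.
  have -> : x `^ (1 - gamma) = x `^ (gamma + 1) * x `^ (- (2 * gamma)).
    rewrite -powRD; last by rewrite (gt_eqF x0) implybT.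
    by congr (_ `^ _); ring.
  have Y3 : x `^ (- (2 * gamma)) <= (1 - gamma) / (2 * lam * (gamma + 1)).
    by rewrite hX3//; move: Xx; rewrite /X; lra.
  set q := x `^ (- (2 * gamma)) in Y3 *.
  rewrite [leRHS](_ : _ = x `^ (gamma + 1) * (2 * lam / (1 - gamma)) *
      ((1 - gamma) / (2 * lam * (gamma + 1)) - q)); last first.
    by field; rewrite ?subr_eq0 ?gt_eqF// ?addr_gt0// gt_eqF//; move: gamma_gt0; lra.
  rewrite mulr_ge0 ?subr_ge0// mulr_ge0 ?powR_ge0// divr_ge0 ?mulr_ge0 ?ltW//.
  by rewrite subr_gt0.
have uD : forall x, X <= x -> u x * (v x - beta x * u x) <= 0.
  apply: (recessive_upper (fun x _ => ud x) vd' Vd betad (G := G) (M := M)) => //.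
  by move=> x Xx; apply: GM; exact: le_trans Xx.
have sq := recessive_square_nincr (fun x _ => ud x) Bd uD.
have unz x : X <= x -> u x != 0.
  move=> Xx; apply/eqP => ux0.
  have u0 y : x <= y -> u y = 0.
    move=> xy; have := sq _ _ Xx xy; rewrite ux0 mul0r expr0n/= => h.
    have : (u y * expR (- upper_exponent y)) ^+ 2 == 0 by rewrite eq_le h sqr_ge0.
    by rewrite sqrf_eq0 mulf_eq0 [X in _ || X]gt_eqF ?expR_gt0// orbF => /eqP.
  have x1 : x < x + 1 by rewrite ltrDl.
  have [c /andP[xc cx1] E] := is_derive_MVT x1 (fun y _ => ud y).
  have vc0 : v c = 0.
    have : v c * (x + 1 - x) = 0 by rewrite -E !u0 ?subrr// ltW.
    by rewrite addrAC subrr add0r mulr1.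
  have := eigen_ode_unique gamma_gt0 uv (u0 c (ltW xc)) vc0 z.
  by move/eqP; apply/negP.
have uc : continuous u by move=> x; exact: is_derive_continuous (ud x).
have [s s2 su] := nonvanishing_constant_sign uc unz.
have [sud _] := eigen_ode_scale s uv.
have svd' x : X <= x ->
    is_derive x 1 (fun x => s * v x) (x `^ gamma * (s * v x) - lam * (s * u x)).
  by move=> Xx; apply: (is_derive_eq (is_derive_mull s (vd' x Xx))); ring.
have lower := positive_solution_lower (fun x _ => sud x) svd' Vd alphad Ad Falpha VA su.
have upper x : X <= x -> s * v x - beta x * (s * u x) <= 0.
  move=> Xx; have : (s * u x) * (s * v x - beta x * (s * u x)) <= 0.
    have -> : (s * u x) * (s * v x - beta x * (s * u x)) =
      s ^+ 2 * (u x * (v x - beta x * u x)) by ring.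
    by rewrite s2 mul1r uD.
  by rewrite pmulr_rle0// su.
have hE (A dA : R -> R) : (forall x, X <= x -> is_derive x 1 A (dA x)) ->
    forall x, X <= x -> is_derive x 1 (fun x => s * u x * expR (- A x))
      ((s * v x - dA x * (s * u x)) * expR (- A x)).
  move=> Add x Xx; apply: (is_derive_eq (is_derive_mul (sud x)
    (is_derive_expR_comp (is_derive_opp (Add x Xx))))).
  by rewrite /=; ring.
have low_mono x : X <= x ->
    s * u X * expR (- growth_exponent X) <= s * u x * expR (- growth_exponent x).
  move=> Xx; apply: (is_derive_ndecr (hE _ _ Ad) _ (lexx X) Xx) => y Xy.
  by rewrite mulr_ge0 ?expR_ge0// lower.
have up_mono x : X <= x ->
    s * u x * expR (- upper_exponent x) <= s * u X * expR (- upper_exponent X).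
  move=> Xx; apply: (is_derive_nincr (hE _ _ Bd) _ (lexx X) Xx) => y Xy.
  by rewrite mulr_le0_ge0 ?expR_ge0// upper.
exists s, X, (s * u X * expR (- growth_exponent X)),
  (s * u X * expR (- upper_exponent X)); split => //.
- by rewrite mulr_gt0 ?expR_gt0 ?su.
- by rewrite mulr_gt0 ?expR_gt0 ?su.
move=> x Xx; split.
- exact: su.
- apply/andP; split.
    by rewrite -ler_pdivlMr ?expR_gt0// -expRN low_mono.
  rewrite -ler_pdivrMr ?expR_gt0// -expRN (le_trans _ (up_mono x Xx))//.
  rewrite ler_pM2l ?su// ler_expR lerN2 /upper_exponent gerDl.
  rewrite mulr_le0_ge0 ?powR_ge0// pmulr_rle0.
    by rewrite invr_le0; move: gamma_gt13; lra.
  by rewrite mulr_gt0 ?exprn_gt0.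
- by have := lower x Xx; rewrite subr_ge0.
- by have := upper x Xx; rewrite subr_le0.
Qed.

End Asymptotics.

(** * Lebesgue integrals and primitives *)

Section LebesgueIntegralFacts.
Context {R : realType}.
Notation mu := (@lebesgue_measure R).

Lemma lebesgue_measure_scale (c : R) (A : set (measurableTypeR R)) :
  c != 0 -> measurable A ->
  (mu A = (`|c|)%:E * mu ((fun x => (c * x)%R) @^-1` A))%E.
Proof.
move=> c0 mA.
have mc : measurable_fun [set: measurableTypeR R] (fun x : measurableTypeR R => c * x).
  exact: mulrl_measurable.
pose nu : {measure set (measurableTypeR R) -> \bar R} :=
  mscale (NngNum (normr_ge0 c))
    (pushforward mu (fun x : measurableTypeR R => c * x : measurableTypeR R)).
rewrite (@lebesgue_measure_unique R (nu mc) _ A mA)// => X /ocitvP[->|[[a b] /= ab ->]].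
  by rewrite !measure0.
rewrite /nu /mscale/= /pushforward.
have [c1|c1] := ltP 0 c.
- rewrite (_ : _ @^-1` _ = `]a / c, b / c]%classic).
    rewrite !lebesgue_measure_itv/= !lte_fin ab ltr_pM2r ?invr_gt0// ab.
    rewrite gtr0_norm// -!EFinB -EFinM; congr EFin; field; exact: c0.
  apply/seteqP; split => x /=; rewrite !in_itv/= ltr_pdivrMr// ler_pdivlMr//;
    by rewrite mulrC.
- have {}c1 : c < 0 by rewrite lt_neqAle c0.
  rewrite (_ : _ @^-1` _ = `[b / c, a / c[%classic).
    rewrite !lebesgue_measure_itv/= !lte_fin ab ltr_nM2r ?invr_lt0// ab.
    rewrite ltr0_norm// -!EFinB -EFinM; congr EFin; field; exact: c0.
  apply/seteqP; split => x /=; rewrite !in_itv/= ltr_ndivlMr// ler_ndivrMr//;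
    by rewrite mulrC andbC.
Qed.

Lemma ge0_integral_scale (c : R) (f : R -> R) : c != 0 ->
  measurable_fun setT f -> (forall x, 0 <= f x) ->
  (\int[mu]_x (f x)%:E = (`|c|)%:E * \int[mu]_x (f (c * x)%R)%:E)%E.
Proof.
move=> c0 mf f0.
have mc : measurable_fun [set: measurableTypeR R] (fun x : measurableTypeR R => c * x).
  exact: mulrl_measurable.
pose nu : {measure set (measurableTypeR R) -> \bar R} :=
  mscale (NngNum (normr_ge0 c))
    (pushforward mu (fun x : measurableTypeR R => c * x : measurableTypeR R)).
rewrite (eq_measure_integral (nu mc)); last first.
  by move=> A mA _; exact: lebesgue_measure_scale.
rewrite ge0_integral_mscale//; last 2 first.
- exact/measurable_EFinP.
- by move=> x _; rewrite lee_fin.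
congr (_ * _)%E.
rewrite ge0_integral_pushforward//.
- exact/measurable_EFinP.
- by move=> x _; rewrite lee_fin.
Qed.

(** The fundamental theorem differentiates an integral only to the right of its
    base point; the base point therefore moves with [x], and subtracting the
    value at 0 makes the result independent of it. *)
Lemma continuous_antiderivative (f : R -> R) : continuous f ->
  exists P : R -> R, forall x : R, is_derive x 1 P (f x).
Proof.
move=> fc.
have fi a b : mu.-integrable `[a, b] (EFin \o f).
  by apply: continuous_compact_integrable;
    [exact: segment_compact|exact: continuous_subspaceT].
pose Q a x := \int[mu]_(t in `[a, x]) f t.
have Qd (a x : R) : a < x -> is_derive x 1 (Q a) (f x).
  move=> ax; have [] := @continuous_FTC1_closed R f a x (x + 1) _ (fi _ _) ax (fc x).
    by rewrite ltrDl.
  by move=> d <-; rewrite derive1E; exact: DeriveDef.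
pose P x := Q (- (`|x| + 1)) x - Q (- (`|x| + 1)) 0.
have PE (a x : R) : 0 < a -> - a < x -> P x = Q (- a) x - Q (- a) 0.
  move=> a0 ax.
  pose m := Num.min a (`|x| + 1).
  have am : a \in [pred b | (m <= b) ] by rewrite inE ge_min lexx.
  have m0 : 0 < m by rewrite lt_min a0/= ltr_wpDl.
  have mx : - m < x.
    rewrite ltrNl lt_min; apply/andP; split; first by rewrite ltrNl.
    by rewrite (le_lt_trans (ler_norm _))// normrN ltrDl.
  have E b : m <= b -> forall y, - m < y -> Q (- b) y - Q (- m) y = Q (- b) 0 - Q (- m) 0.
    move=> mb; have d (y : R) : - m < y ->
        is_derive y 1 (fun y => Q (- b) y - Q (- m) y) 0.
      move=> my; have by_ : - b < y by rewrite (le_lt_trans _ my)// lerN2.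
      by have := is_derive_sub (Qd _ _ by_) (Qd _ _ my); rewrite subrr.
    have h (y z : R) : - m < y -> y < z -> Q (- b) z - Q (- m) z = Q (- b) y - Q (- m) y.
      move=> my yz.
      have [w /andP[yw _]|c _ /eqP] := @is_derive_MVT R
        (fun y => Q (- b) y - Q (- m) y) (fun=> 0) y z yz.
        by apply: (d w); exact: lt_le_trans yw.
      by rewrite mul0r subr_eq0 => /eqP.
    move=> y my; have [y0|y0|->//] := ltgtP y 0.
      by rewrite -(h y 0).
    by rewrite -(h 0 y)// oppr_lt0.
  have E1 := E a ltac:(by rewrite ge_min lexx) x mx.
  have E2 := E (`|x| + 1) ltac:(by rewrite ge_min lexx orbT) x mx.
  by rewrite /P; lra.
exists P => x.
have x2 : 0 < `|x| + 1 by rewrite ltr_wpDl.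
apply: (@near_eq_is_derive _ _ _ (fun y => Q (- (`|x| + 1)) y - Q (- (`|x| + 1)) 0)).
  near=> y; rewrite (PE (`|x| + 1))//.
  near: y; apply: lt_nbhsr.
  by rewrite ltrNl (le_lt_trans (ler_norm _))// normrN ltrDl.
rewrite -[f x]subr0; apply: is_derive_sub.
by apply: Qd; rewrite ltrNl (le_lt_trans (ler_norm _))// normrN ltrDl.
Unshelve. all: by end_near. Qed.

Lemma integral_itv_antiderivative (f P : R -> R) (a b : R) :
  continuous f -> (forall x : R, is_derive x 1 P (f x)) -> a < b ->
  (\int[mu]_(x in `[a, b]) (f x)%:E = (P b - P a)%:E)%E.
Proof.
move=> fc Pd ab; rewrite (continuous_FTC2 ab _ _ (F := P)) ?EFinB//.
- exact: continuous_subspaceT.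
- have Pc x : P y @[y --> x] --> P x by exact: is_derive_continuous (Pd x).
  split; first by move=> x _; have [] := Pd x.
  + exact: cvg_at_right_filter.
  + exact: cvg_at_left_filter.
- by move=> x _; rewrite derive1E; have [] := Pd x.
Qed.

Lemma antiderivative_bounded (g G : R -> R) :
  continuous g -> (forall x, 0 <= g x) ->
  (forall x : R, is_derive x 1 G (g x)) ->
  mu.-integrable setT (EFin \o g) ->
  exists M, forall x, 1 <= x -> G x <= M.
Proof.
move=> gc g0 Gd gi.
exists (fine (\int[mu]_x (g x)%:E) + G 0) => x x1.
have x0 : 0 < x by rewrite (lt_le_trans _ x1).
rewrite -lerBlDr -lee_fin -(integral_itv_antiderivative gc Gd x0).
rewrite fineK; last by exact: integrable_fin_num gi.
apply: ge0_subset_integral => //.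
- by apply/measurable_EFinP; exact: continuous_measurable_fun.
- by move=> y _; rewrite lee_fin.
Qed.

Lemma Rintegral_indic_itvoo (f P : R -> R) (k a b : R) :
  continuous f -> (forall x : R, is_derive x 1 P (f x)) -> a < b ->
  \int[mu]_x (k * \1_(`]a, b[%classic) x * f x) = k * (P b - P a).
Proof.
move=> fc Pd ab.
have kfc : continuous (fun x => k * f x).
  by move=> x; apply: cvgM; [exact: cvg_cst|exact: fc].
transitivity (\int[mu]_(x in `]a, b[) (k * f x)).
  rewrite [RHS]Rintegral_mkcond; apply: eq_Rintegral => x _.
  rewrite patchE indicE; case: (x \in `]a, b[%classic) => /=.
    by rewrite mulr1.
  by rewrite mulr0 mul0r.
have kfm (A : set R) : measurable_fun A (fun x => (k * f x)%:E).
  by apply/measurable_EFinP; apply: measurable_funTS; exact: continuous_measurable_fun.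
rewrite /Rintegral integral_itv_bndo_bndc// integral_itv_obnd_cbnd//.
rewrite (@integral_itv_antiderivative _ (fun x => k * P x))//= ?mulrBr//.
Qed.

End LebesgueIntegralFacts.

(** * Rescaling of eigenfunctions *)

Section EigenfunctionScaling.
Context {R : realType}.
Notation mu := (@lebesgue_measure R).
Implicit Types (f u v w : R -> R) (gamma eps l c : R).

Lemma ge0_Rintegral_scale c f : c != 0 -> measurable_fun setT f ->
  (forall x, 0 <= f x) ->
  \int[mu]_x f x = `|c| * \int[mu]_x f (c * x).
Proof.
move=> c0 mf f0; rewrite /Rintegral (ge0_integral_scale c0)//.
have : (0 <= \int[mu]_x (f (c * x)%R)%:E)%E.
  by apply: integral_ge0 => x _; rewrite lee_fin.
case: (\int[mu]_x (f (c * x)%R)%:E)%E => [r _| _|//].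
  by rewrite -EFinM.
by rewrite mulry gtr0_sg ?normr_gt0// mul1e mulr0.
Qed.

Lemma ge0_RintegralZl k f : 0 <= k -> measurable_fun setT f ->
  (forall x, 0 <= f x) -> \int[mu]_x (k * f x) = k * \int[mu]_x f x.
Proof.
rewrite le_eqVlt => /predU1P[<- _ _|k0 mf f0].
  rewrite mul0r (_ : (fun _ => _) = cst 0) ?Rintegral_cst ?mul0r//.
  by apply/funext => x; rewrite mul0r.
rewrite /Rintegral; under eq_integral do rewrite EFinM.
rewrite ge0_integralZl_EFin ?(ltW k0)//; last 2 first.
- by move=> x _; rewrite lee_fin.
- exact/measurable_EFinP.
have : (0 <= \int[mu]_x (f x)%:E)%E by apply: integral_ge0 => x _; rewrite lee_fin.
case: (\int[mu]_x (f x)%:E)%E => [r _| _|//]; first by rewrite -EFinM.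
by rewrite mulry gtr0_sg// mul1e mulr0.
Qed.

Lemma measurable_potential gamma : measurable_fun setT (@potential R gamma).
Proof.
apply: measurable_funM => //; apply: (measurableT_comp (measurable_powR _)).
exact: normr_measurable.
Qed.

Lemma measurable_gibbs_weight gamma eps :
  measurable_fun setT (@gibbs_weight R gamma eps).
Proof.
apply: (measurableT_comp (@measurable_expR R)).
apply: measurable_funM => //; apply: measurableT_comp => //.
exact: measurable_potential.
Qed.

Lemma measurable_gibbs gamma eps : measurable_fun setT (@gibbs R gamma eps).
Proof. by apply: measurable_funM => //; exact: measurable_gibbs_weight. Qed.

Lemma gibbs_ge0 gamma eps x : 0 <= @gibbs R gamma eps x.
Proof.
rewrite mulr_ge0 ?expR_ge0// invr_ge0 Rintegral_ge0// => y _.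
exact: expR_ge0.
Qed.

Lemma inner_mull gamma eps (s : R) f : measurable_fun setT f ->
  inner gamma eps (fun x => s * f x) (fun x => s * f x) = s ^+ 2 * inner gamma eps f f.
Proof.
move=> mf; rewrite /inner -ge0_RintegralZl ?sqr_ge0//.
- by apply: eq_Rintegral => x _; ring.
- by apply: measurable_funM; [exact: measurable_funM|exact: measurable_gibbs].
- by move=> x; rewrite mulr_ge0 ?gibbs_ge0// -expr2 sqr_ge0.
Qed.

Section Scale.
Variables (gamma c eps1 eps2 : R).
Hypotheses (gamma_gt0 : 0 < gamma) (c0 : c != 0) (eps1_gt0 : 0 < eps1).
Hypothesis ceps : `|c| `^ (gamma + 1) * eps1 = eps2.

(** The relation between [eps1] and [eps2] says that
    [V (c y) / eps2 = V y / eps1]. It covers the zoom that brings the noise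
    level to 1 as well as the reflection [c = -1]. *)
Lemma gibbs_weight_scale y :
  gibbs_weight gamma eps2 (c * y) = gibbs_weight gamma eps1 y.
Proof.
rewrite /gibbs_weight /potential normrM powRM// -ceps; congr expR; field.
by rewrite !gt_eqF ?powR_gt0 ?normr_gt0// addr_gt0.
Qed.

Lemma gibbs_scale y : gibbs gamma eps2 (c * y) = `|c|^-1 * gibbs gamma eps1 y.
Proof.
rewrite /gibbs gibbs_weight_scale (ge0_Rintegral_scale c0); last 2 first.
- exact: measurable_gibbs_weight.
- by move=> x; exact: expR_ge0.
under eq_Rintegral do rewrite gibbs_weight_scale.
by rewrite invfM mulrA.
Qed.

Lemma inner_scale f : measurable_fun setT f ->
  inner gamma eps1 (fun x => f (c * x)) (fun x => f (c * x)) =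
  inner gamma eps2 f f.
Proof.
move=> mf; rewrite /inner [RHS](ge0_Rintegral_scale c0); last 2 first.
- by apply: measurable_funM; [exact: measurable_funM|exact: measurable_gibbs].
- by move=> x; rewrite mulr_ge0 ?gibbs_ge0// -expr2 sqr_ge0.
have mfc : measurable_fun setT (fun x => f (c * x)).
  by apply: (measurableT_comp mf); exact: mulrl_measurable.
under [in RHS]eq_Rintegral do rewrite gibbs_scale mulrCA.
rewrite ge0_RintegralZl.
- by rewrite mulrA mulfV ?mul1r// normr_eq0.
- by rewrite invr_ge0.
- by apply: measurable_funM; [exact: measurable_funM|exact: measurable_gibbs].
- by move=> x; rewrite mulr_ge0 ?gibbs_ge0// -expr2 sqr_ge0.
Qed.

Lemma sqintegrable_scale f :
  sqintegrable gamma eps2 f -> sqintegrable gamma eps1 (fun x => f (c * x)).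
Proof.
move=> [mf fi].
have mfc : measurable_fun setT (fun x => f (c * x)).
  by apply: (measurableT_comp mf); exact: mulrl_measurable.
split => //.
have mh : measurable_fun setT (fun x => f x ^+ 2 * gibbs gamma eps2 x).
  by apply: measurable_funM; [exact: measurable_funX|exact: measurable_gibbs].
have h0 x : 0 <= f x ^+ 2 * gibbs gamma eps2 x.
  by rewrite mulr_ge0 ?gibbs_ge0 ?sqr_ge0.
apply/integrableP; split.
  apply/measurable_EFinP.
  by apply: measurable_funM; [exact: measurable_funX|exact: measurable_gibbs].
move/integrableP : fi => [_].
under eq_integral do rewrite gee0_abs ?lee_fin//.
rewrite (ge0_integral_scale c0 mh h0).
under eq_integral do rewrite gibbs_scale mulrCA EFinM.
have g0 x : 0 <= f (c * x) ^+ 2 * gibbs gamma eps1 x.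
  by rewrite mulr_ge0 ?gibbs_ge0 ?sqr_ge0.
rewrite ge0_integralZl_EFin ?invr_ge0//; last 2 first.
- by move=> x _; rewrite lee_fin.
- apply/measurable_EFinP.
  by apply: measurable_funM; [exact: measurable_funX|exact: measurable_gibbs].
rewrite muleA -EFinM mulfV ?normr_eq0// mul1e.
by under [in X in _ -> X]eq_integral do rewrite gee0_abs ?lee_fin//.
Qed.

(** The operators at the two noise levels are conjugate under [x = c y] up to
    the factor [|c| ^ (1 - gamma)], because [V'] is homogeneous of degree
    [gamma] and [eps2 = |c| ^ (gamma + 1) eps1]. *)
Lemma eigenfunction_scale l u : eigenfunction gamma eps2 l u ->
  eigenfunction gamma eps1 (l * `|c| `^ (1 - gamma)) (fun x => u (c * x)).
Proof.
move=> [su [z uz] du du' uE].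
pose u1 := (u^`())%classic; pose u2 := (u1^`())%classic.
have du1 (x : R) : is_derive x 1 (fun x => u (c * x)) (c * u1 (c * x)).
  by apply: is_derive_scale_arg; rewrite /u1 derive1E; exact: DeriveDef.
have D1 : ((fun x => u (c * x))^`())%classic = (fun x => c * u1 (c * x)).
  by apply/funext => x; rewrite derive1E; have [] := du1 x.
have du2 (x : R) : is_derive x 1 (fun x => c * u1 (c * x)) (c * (c * u2 (c * x))).
  apply: is_derive_mull; apply: is_derive_scale_arg.
  by rewrite /u2 derive1E; exact: DeriveDef.
have D2 : ((fun x => c * u1 (c * x))^`())%classic = (fun x => c * (c * u2 (c * x))).
  by apply/funext => x; rewrite derive1E; have [] := du2 x.
have VE (x : R) : ((potential gamma)^`())%classic x = Num.sg x * `|x| `^ gamma.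
  by rewrite derive1E; have [] := is_derive_potential x gamma_gt0.
split.
- exact: sqintegrable_scale.
- by exists (c^-1 * z); rewrite mulrA mulfV// mul1r.
- by move=> x; have [] := du1 x.
- by move=> x; rewrite D1; have [] := du2 x.
- move=> x; have := uE (c * x); rewrite /generator /derive1n/= D1 D2 !VE.
  rewrite -/u1 -/u2 [X in _ -> _ = X]mulrAC => <-; rewrite normrM powRM// sgrM -ceps.
  have cg : `|c| `^ gamma * `|c| `^ (1 - gamma) = `|c|.
    rewrite -powRD; last by rewrite normr_eq0 c0 implybT.
    by rewrite addrCA subrr addr0 powRr1.
  have cg1 : `|c| `^ (gamma + 1) * `|c| `^ (1 - gamma) = c * c.
    rewrite -powRD; last by rewrite normr_eq0 c0 implybT.
    rewrite (_ : gamma + 1 + (1 - gamma) = 2%:R); last by ring.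
    by rewrite powR_mulrn// -expr2 real_normK// num_real.
  have cs : Num.sg c * `|c| = c by rewrite -numEsg.
  transitivity (- ((c * c) * eps1 * u2 (c * x)
     - Num.sg x * `|x| `^ gamma * ((Num.sg c * `|c|) * u1 (c * x)))).
    by rewrite cs; ring.
  by rewrite -cg1 -[in Num.sg c * `|c|]cg; ring.
Qed.

End Scale.
End EigenfunctionScaling.

(** * Spectral systems *)

Lemma increasing_same_range_eq (R : realType) (f g : nat -> R) :
  {homo f : i j / (i < j)%N >-> i < j} -> {homo g : i j / (i < j)%N >-> i < j} ->
  (forall i, exists j, f i = g j) -> (forall i, exists j, g i = f j) ->
  forall i, f i = g i.
Proof.
move=> fi gi fg gf; elim/ltn_ind => k IH.
have fge j : (k <= j)%N -> f k <= f j.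
  by rewrite leq_eqVlt => /predU1P[->//|/fi/ltW].
have gge j : (k <= j)%N -> g k <= g j.
  by rewrite leq_eqVlt => /predU1P[->//|/gi/ltW].
have [j fkj] := fg k; have [i gki] := gf k.
have kj : (k <= j)%N.
  rewrite leqNgt; apply/negP => jk.
  by have := fi _ _ jk; rewrite fkj IH// ltxx.
have ki : (k <= i)%N.
  rewrite leqNgt; apply/negP => ik.
  by have := gi _ _ ik; rewrite gki IH// ltxx.
by apply/eqP; rewrite eq_le {1}gki fge// fkj gge.
Qed.

Section SpectralSystems.
Context {R : realType}.
Variable gamma : R.
Hypothesis gamma_gt0 : 0 < gamma.
Implicit Types (l : nat -> R) (psi : nat -> R -> R) (eps c x : R).

(** Rescaling maps eigenfunctions to eigenfunctions in both directions, so the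
    two sequences of eigenvalues enumerate the same set increasingly.
    Simplicity then gives proportional eigenfunctions, and normalisation fixes
    the factor up to sign. *)
Lemma spectral_system_scale eps1 eps2 c l1 l2 psi1 psi2 :
  c != 0 -> 0 < eps1 -> 0 < eps2 -> `|c| `^ (gamma + 1) * eps1 = eps2 ->
  spectral_system gamma eps1 l1 psi1 -> spectral_system gamma eps2 l2 psi2 ->
  forall k, l1 k = l2 k * `|c| `^ (1 - gamma) /\
    exists2 s : R, s ^+ 2 = 1 & forall x, psi1 k x = s * psi2 k (c * x).
Proof.
move=> c0 e1 e2 ceps [[_ _ l1i] _ ef1 sp1 [sq1 on1 _]] [[_ _ l2i] _ ef2 sp2 [sq2 on2 _]].
have nc0 : 0 < `|c| by rewrite normr_gt0.
have ceps' : `|c^-1| `^ (gamma + 1) * eps2 = eps1.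
  rewrite -ceps mulrA -powRM// -normrM mulVf// normr1 powR1 mul1r//.
have cc : `|c^-1| `^ (1 - gamma) * `|c| `^ (1 - gamma) = 1.
  by rewrite -powRM// -normrM mulVf// normr1 powR1.
have l12 : forall k, l1 k = l2 k * `|c| `^ (1 - gamma).
  apply: increasing_same_range_eq => //.
  - by move=> i j ij; rewrite ltr_pM2r ?powR_gt0// l2i.
  - move=> i; have c0' : c^-1 != 0 by rewrite invr_eq0.
    have [j [E _]] := sp2 _ _ (eigenfunction_scale gamma_gt0 c0' e2 ceps' (ef1 i)).
    by exists j; rewrite -E -mulrA cc mulr1.
  - move=> i.
    have [j [E _]] := sp1 _ _ (eigenfunction_scale gamma_gt0 c0 e1 ceps (ef2 i)).
    by exists j.
move=> k; split => //.
have [j [E [s sE]]] := sp1 _ _ (eigenfunction_scale gamma_gt0 c0 e1 ceps (ef2 k)).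
have jk : j = k.
  move: E; rewrite -l12 => E; have [kj|jk|//] := ltngtP j k.
    by have := l1i _ _ kj; rewrite E ltxx.
  by have := l1i _ _ jk; rewrite E ltxx.
subst j.
have sE' : (fun x => psi2 k (c * x)) = (fun x => s * psi1 k x) by exact/funext.
have s2 : s ^+ 2 = 1.
  have := on2 k k; rewrite eqxx -(inner_scale gamma_gt0 c0 e1 ceps (sq2 k).1) sE'.
  by rewrite inner_mull ?on1 ?eqxx ?mulr1//; exact: (sq1 k).1.
by exists s => // x; rewrite sE mulrA -expr2 s2 mul1r.
Qed.

Lemma spectral_system_parity eps l psi : 0 < eps ->
  spectral_system gamma eps l psi -> forall k,
    exists2 s : R, s ^+ 2 = 1 & forall x, psi k x = s * psi k (-1 * x).
Proof.
move=> e0 S k; have N1 : (-1 : R) != 0 by rewrite oppr_eq0 oner_neq0.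
have h : `|-1 : R| `^ (gamma + 1) * eps = eps.
  by rewrite normrN normr1 powR1 mul1r.
by have [] := spectral_system_scale N1 e0 e0 h S S k.
Qed.

Lemma eigenfunction_ode lam u : eigenfunction gamma 1 lam u ->
  eigen_ode gamma lam u (u^`())%classic.
Proof.
move=> [_ _ du du' uE]; split=> x; first by rewrite derive1E; exact: DeriveDef.
have := uE x; rewrite /generator /derive1n/= mul1r.
have -> : ((potential gamma)^`())%classic x = Num.sg x * `|x| `^ gamma.
  by rewrite derive1E; have [] := is_derive_potential x gamma_gt0.
move=> E; have -> : Num.sg x * `|x| `^ gamma * (u^`())%classic x - lam * u x =
    ((u^`())^`())%classic x by rewrite -E; ring.
by rewrite derive1E; exact: DeriveDef.
Qed.

Lemma eigenfunction_continuous eps lam u : eigenfunction gamma eps lam u -> continuous u.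
Proof.
by move=> [_ _ du _ _] x; apply/differentiable_continuous/derivable1_diffP.
Qed.

Lemma continuous_potential : continuous (@potential R gamma).
Proof.
by move=> x; exact: is_derive_continuous (is_derive_potential x gamma_gt0).
Qed.

(** This is the form in which [eigen_ode_asymptotics] uses square
    integrability. *)
Lemma spectral_system_antiderivative_bound l psi k :
  spectral_system gamma 1 l psi -> exists (G : R -> R) (M : R),
    (forall x : R, is_derive x 1 G (psi k x ^+ 2 * expR (- potential gamma x))) /\
    (forall x, 1 <= x -> G x <= M).
Proof.
move=> [_ _ ef _ [sq on _]].
have pc := eigenfunction_continuous (ef k).
pose g x := psi k x ^+ 2 * expR (- potential gamma x).
have gc : continuous g.
  move=> x; apply: cvgM.
    by under eq_fun do rewrite expr2; rewrite expr2; apply: cvgM; exact: pc.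
  apply: continuous_comp; last exact: continuous_expR.
  by apply: cvgN; exact: continuous_potential.
have [G Gd] := continuous_antiderivative gc.
have gi : (@lebesgue_measure R).-integrable setT (EFin \o g).
  have [_ si] := sq k.
  pose Z := \int[@lebesgue_measure R]_y gibbs_weight gamma 1 y.
  have Z0 : Z != 0.
    (* A null partition function would make every inner product vanish. *)
    apply/eqP => Z0; have := on 0%N 0%N; rewrite eqxx /inner /gibbs -/Z Z0 invr0.
    under eq_Rintegral do rewrite mul0r mulr0.
    rewrite Rintegral_cst ?mul0r// => /eqP.
    by rewrite eq_sym oner_eq0.
  rewrite (_ : _ \o _ = (fun x => Z%:E * (psi k x ^+ 2 * gibbs gamma 1 x)%:E)%E).
    exact: integrableZl.
  apply/funext => x; rewrite /= -EFinM; congr EFin.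
  by rewrite /g /gibbs -/Z /gibbs_weight divr1; field.
have g0 x : 0 <= g x by rewrite mulr_ge0 ?sqr_ge0 ?expR_ge0.
by have [M GM] := antiderivative_bounded gc g0 Gd gi; exists G, M.
Qed.

End SpectralSystems.

(** * Means of eigenfunctions over windows *)

Section WindowMeans.
Context {R : realType}.
Variables (gamma lam : R).
Hypothesis gamma_gt0 : 0 < gamma.
Hypothesis gamma_lt1 : gamma < 1.
Hypothesis lam_gt0 : 0 < lam.
Implicit Types (u v P : R -> R).

Lemma norm_sign_mul (s x : R) : s ^+ 2 = 1 -> 0 < s * x -> `|x| = s * x.
Proof.
move=> s2 sx; have s1 := sqr_eq1_norm s2.
by rewrite -[LHS]mul1r -s1 -normrM gtr0_norm.
Qed.

Lemma powR_increment_le (m y z : R) : 0 < m -> m <= y -> m <= z ->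
  `|y `^ (1 - gamma) - z `^ (1 - gamma)|
    <= (1 - gamma) * m `^ (- gamma) * `|y - z|.
Proof.
move=> m0; wlog zy : y z / z <= y => [W my mz|my mz].
  have [zy|yz] := leP z y; first exact: W.
  by rewrite distrC [`|y - z|]distrC; apply: W => //; exact: ltW.
move: zy; rewrite le_eqVlt => /predU1P[->|zy].
  by rewrite !subrr normr0 mulr0.
have [x /andP[zx xy]|w /andP[zw wy] ->] := @is_derive_MVT R (fun x => x `^ (1 - gamma))
   (fun x => (1 - gamma) * x `^ (1 - gamma - 1)) z y zy.
  by apply: is_derive1_powR; rewrite (lt_le_trans m0)// (le_trans mz).
have w0 : 0 < w by rewrite (le_lt_trans _ zw)// (le_trans (ltW m0)).
rewrite normrM ler_wpM2r// ger0_norm; last first.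
  by rewrite mulr_ge0 ?powR_ge0// subr_ge0 ltW.
rewrite addrAC subrr add0r ler_wpM2l ?subr_ge0 ?(ltW gamma_lt1)//.
rewrite !powRN lef_pV2 ?posrE ?powR_gt0//.
apply: ge0_ler_powR; rewrite ?nnegrE ?(ltW m0) ?(ltW w0) ?(ltW gamma_gt0)//.
exact: le_trans mz (ltW zw).
Qed.

(** By the mean value theorem the mean is [u w] with [|w|] at distance at most
    [b ^ gamma] of [b |x0|]. On such a window [x ^ (1 - gamma)] varies by at
    most [(1 - gamma) (b |x0| / 2) ^ (- gamma) b ^ gamma], which does not
    depend on [b]. *)
Lemma window_mean_away u v P s X c C x0 :
  s ^+ 2 = 1 -> 0 < c -> 0 < C -> recessive_growth gamma lam u v s X c C ->
  (forall x, `|u x| = `|u `|x| |) ->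
  (forall x : R, is_derive x 1 P (u x)) -> x0 != 0 ->
  exists A B K : R, [/\ 0 < A, 0 < B & forall b, K <= b ->
    A * expR (growth_exponent gamma lam (b * `|x0|)) <=
      `|(P (b * x0 + b `^ gamma) - P (b * x0 - b `^ gamma)) / (2 * b `^ gamma)|
    <= B * expR (growth_exponent gamma lam (b * `|x0|))].
Proof.
move=> s2 c0 C0 G uabs Pd x00.
have nx0 : 0 < `|x0| by rewrite normr_gt0.
have x20 : 0 < `|x0| / 2 by rewrite divr_gt0.
(* Beyond [K1] the half-width is at most [b |x0| / 2]. *)
have [||K1 K11 hK1] := @powR_eventually_small R (1 - gamma) (`|x0| / 2) => //.
  by rewrite subr_gt0.
pose D := lam * (`|x0| / 2) `^ (- gamma).
exists (c * expR (- D)), (C * expR D), (K1 + `|X| * (`|x0| / 2)^-1).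
split; [by rewrite mulr_gt0 ?expR_gt0|by rewrite mulr_gt0 ?expR_gt0|move=> b Kb].
have K1b : K1 <= b by rewrite (le_trans _ Kb)// lerDl mulr_ge0 ?invr_ge0 ?(ltW x20).
have b0 : 0 < b by rewrite (lt_le_trans ltr01)// (le_trans K11).
set h := b `^ gamma; have h0 : 0 < h by rewrite powR_gt0.
have hb : h <= b * (`|x0| / 2).
  have -> : h = b * b `^ (- (1 - gamma)).
    rewrite -{1}[b]powRr1 ?(ltW b0)// -powRD; last by rewrite (gt_eqF b0) implybT.
    by rewrite opprB addrC subrK.
  by rewrite ler_pM2l// hK1.
have Xb : X <= b * (`|x0| / 2).
  rewrite (le_trans (ler_norm _))// -ler_pdivrMr// (le_trans _ Kb)// lerDr.
  by rewrite (le_trans _ K11).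
have hh : b * x0 - h < b * x0 + h by rewrite ltrD2l; lra.
have [w /andP[w1 w2] ->] := is_derive_MVT hh (fun x _ => Pd x).
rewrite (_ : _ + h - _ = 2 * h); last by ring.
rewrite mulfK; last by rewrite mulf_neq0 ?gt_eqF.
have bx : `|b * x0| = b * `|x0| by rewrite normrM gtr0_norm.
have wx : `| `|w| - b * `|x0| | <= h.
  rewrite -bx (le_trans (ler_dist_dist _ _))// ler_norml.
  by apply/andP; split; lra.
have wm : b * (`|x0| / 2) <= `|w|.
  move: wx; rewrite ler_norml => /andP[wx _]; lra.
have [su bds _ _] := G _ (le_trans Xb wm).
rewrite uabs (norm_sign_mul s2 su).
have m0 : 0 < b * (`|x0| / 2) by rewrite mulr_gt0.
have bm : b * (`|x0| / 2) <= b * `|x0| by rewrite ler_pM2l//; lra.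
have := powR_increment_le m0 wm bm.
move/le_trans => /(_ ((1 - gamma) * (b * (`|x0| / 2)) `^ (- gamma) * h)).
have g1 : 0 < 1 - gamma by rewrite subr_gt0.
have mg : 0 < (1 - gamma) * (b * (`|x0| / 2)) `^ (- gamma).
  by rewrite (mulr_gt0 g1)// powR_gt0.
rewrite (ler_pM2l mg) => /(_ wx).
have -> : (1 - gamma) * (b * (`|x0| / 2)) `^ (- gamma) * h =
    (1 - gamma) * (`|x0| / 2) `^ (- gamma).
  rewrite powRM ?(ltW b0) ?(ltW x20)// -mulrA; congr (_ * _).
  by rewrite (powRN b) -/h mulrAC mulVf ?mul1r// gt_eqF.
move=> inc.
have LD : `|growth_exponent gamma lam `|w| - growth_exponent gamma lam (b * `|x0|)| <= D.
  rewrite /growth_exponent -mulrBr -mulrBl !normrM (gtr0_norm lam_gt0).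
  rewrite /D ler_pM2l// normfV (gtr0_norm g1) ler_pdivrMr//.
  by rewrite [leRHS]mulrC.
move: LD; rewrite ler_norml => /andP[L1 L2].
move: bds => /andP[b1 b2]; apply/andP; split.
  apply: le_trans b1; rewrite -mulrA -expRD ler_pM2l// ler_expR; lra.
apply: le_trans b2 _; rewrite -mulrA -expRD ler_pM2l// ler_expR; lra.
Qed.

Lemma parity_norm u s : s ^+ 2 = 1 -> (forall x, u x = s * u (-1 * x)) ->
  forall x, `|u x| = `|u `|x| |.
Proof.
move=> s2 uE x; have [x0|x0] := leP 0 x; first by rewrite (ger0_norm x0).
have s1 := sqr_eq1_norm s2.
by rewrite uE normrM s1 mul1r mulN1r (ltr0_norm x0).
Qed.

(** An even solution has zero derivative at 0, so if it also vanishes there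
    then it vanishes identically: the value at 0 decides the parity. *)
Lemma eigen_ode_parity_at0 u v s : eigen_ode gamma lam u v ->
  (exists x, u x != 0) -> s ^+ 2 = 1 -> (forall x, u x = s * u (-1 * x)) ->
  forall x, u (-1 * x) = if u 0 == 0 then - u x else u x.
Proof.
move=> uv [z uz] s2 uE x; case: eqP => [u0|/eqP u0]; last first.
  have s1 : s = 1.
    by have := uE 0; rewrite mulr0 -[LHS]mul1r => /(mulIf u0).
  by rewrite [RHS]uE s1 mul1r.
have /orP[/eqP s1|/eqP s1] : (s == 1) || (s == -1) by rewrite -sqrf_eq1 s2.
- have [ud _] := uv.
  have h : is_derive (0 : R) 1 (fun y => u (-1 * y)) (-1 * v (-1 * 0)).
    by apply: is_derive_scale_arg; exact: ud.
  have uu : (fun y => u (-1 * y)) = u by apply/funext => y; rewrite [RHS]uE s1 mul1r.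
  have v0 : v 0 = 0.
    have [_ h1] := ud 0; have [_] := h; rewrite uu h1 mulr0 mulN1r => hv.
    by apply/eqP; rewrite -oppr_eq0 -[X in X == _]hv; apply/eqP; lra.
  by have := eigen_ode_unique gamma_gt0 uv u0 v0 z => /eqP; rewrite (negbTE uz).
- by rewrite [X in _ = - X]uE s1; set w := u _; rewrite mulN1r opprK.
Qed.

Lemma odd_window_mean0 u P : (forall x, u (-1 * x) = - u x) ->
  (forall x : R, is_derive x 1 P (u x)) -> forall h, P h - P (- h) = 0.
Proof.
move=> uodd Pd h.
have := @is_derive_0_is_cst R (fun x => P x - P (-1 * x)) h 0.
rewrite mulr0 subrr mulN1r; apply => x.
have := is_derive_sub (Pd x) (is_derive_scale_arg (Pd (-1 * x))).
by rewrite uodd mulrNN mul1r subrr.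
Qed.

(** The function [q y = y ^ gamma u y] has a derivative between [lam u] and
    [2 lam u] at infinity, hence it is comparable to the integral of [u]; the
    constants of integration are absorbed because [q] tends to infinity. *)
Lemma window_mean_center u v P s X c C :
  s ^+ 2 = 1 -> 1 <= X -> 0 < c -> 0 < C -> recessive_growth gamma lam u v s X c C ->
  (forall x : R, is_derive x 1 u (v x)) ->
  (forall x, u (-1 * x) = u x) ->
  (forall x : R, is_derive x 1 P (u x)) ->
  exists A B K : R, [/\ 0 < A, 0 < B & forall h, K <= h ->
    A * (h `^ (gamma - 1) * expR (growth_exponent gamma lam h)) <=
      `|(P h - P (- h)) / (2 * h)|
    <= B * (h `^ (gamma - 1) * expR (growth_exponent gamma lam h))].
Proof.
move=> s2 X1 c0 C0 G ud ueven Pd.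
have g2 : 0 < 2 * gamma by rewrite mulr_gt0.
have g1 : 0 < 1 - gamma by rewrite subr_gt0.
have l4 : 0 < (4 * lam)^-1 by rewrite invr_gt0 mulr_gt0.
have l2 : 0 < lam / 2 by rewrite divr_gt0.
have [Y1 Y11 hY1] := powR_eventually_small g2 l4.
have [Y2 Y21 hY2] := powR_eventually_small g1 l2.
pose Y := X + Y1 + Y2.
have Y0 : 1 <= Y by rewrite /Y; lra.
have Ypos x : Y <= x -> 0 < x by move=> Yx; lra.
pose q x := x `^ gamma * (s * u x).
pose dq x := gamma * x `^ (gamma - 1) * (s * u x) + x `^ gamma * (s * v x).
pose S x := s * (P x - P (-1 * x)).
have qd x : Y <= x -> is_derive x 1 q (dq x).
  move=> Yx; exact: is_derive_mul (is_derive1_powR gamma (Ypos x Yx))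
    (is_derive_mull s (ud x)).
have Sd (x : R) : is_derive x 1 S (2 * (s * u x)).
  apply: (is_derive_eq (is_derive_mull s
    (is_derive_sub (Pd x) (is_derive_scale_arg (Pd (-1 * x)))))).
  by rewrite ueven; ring.
have dq_bounds x : Y <= x -> lam * (s * u x) <= dq x <= 2 * lam * (s * u x).
  move=> Yx; have x0 := Ypos x Yx.
  have Xx : X <= x by move: Yx; rewrite /Y; lra.
  have [su _ lo up] := G x Xx.
  have xg : 0 < x `^ gamma by rewrite powR_gt0.
  have xx : x `^ gamma * x `^ (- gamma) = 1.
    by rewrite powRN mulfV// gt_eqF.
  have x3 : x `^ gamma * x `^ (- (3 * gamma)) = x `^ (- (2 * gamma)).
    rewrite -powRD; last by rewrite (gt_eqF x0) implybT.
    by congr (_ `^ _); ring.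
  have xs1 : x `^ (- (2 * gamma)) <= (4 * lam)^-1.
    by apply: hY1; move: Yx; rewrite /Y; lra.
  have xs2 : x `^ (gamma - 1) <= lam / 2.
    by rewrite -opprB; apply: hY2; move: Yx; rewrite /Y; lra.
  have lo' : lam * (s * u x) <= x `^ gamma * (s * v x).
    rewrite (_ : _ * _ = x `^ gamma * (lam * x `^ (- gamma) * (s * u x))).
      by rewrite ler_pM2l.
    by rewrite -[LHS]mul1r -xx; ring.
  have up' : x `^ gamma * (s * v x) <=
      (lam + 2 * lam ^+ 2 * x `^ (- (2 * gamma))) * (s * u x).
    rewrite -x3 (_ : _ * (s * u x) = x `^ gamma * ((lam * x `^ (- gamma) +
      2 * lam ^+ 2 * x `^ (- (3 * gamma))) * (s * u x))).
      by rewrite ler_pM2l.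
    rewrite (_ : _ * _ = x `^ gamma * x `^ (- gamma) * lam * (s * u x) +
      2 * lam ^+ 2 * (x `^ gamma * x `^ (- (3 * gamma))) * (s * u x)).
      by ring.
    by rewrite xx; ring.
  have gs0 : 0 <= gamma * x `^ (gamma - 1) by rewrite mulr_ge0 ?powR_ge0// ltW.
  apply/andP; split; rewrite /dq.
    by apply: le_trans lo' _; rewrite lerDr mulr_ge0// ltW.
  apply: le_trans (lerD (lexx _) up') _; rewrite -mulrDl ler_pM2r//.
  have h1 : 2 * lam ^+ 2 * x `^ (- (2 * gamma)) <= lam / 2.
    apply: le_trans (_ : 2 * lam ^+ 2 * (4 * lam)^-1 <= _).
      by rewrite ler_pM2l// mulr_gt0// exprn_gt0.
    by rewrite le_eqVlt; apply/orP; left; apply/eqP; field; rewrite gt_eqF.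
  have h2 : gamma * x `^ (gamma - 1) <= lam / 2.
    by apply: le_trans xs2; rewrite ler_piMl ?powR_ge0// ltW.
  by lra.
have upper h : Y <= h -> q Y - lam / 2 * S Y <= q h - lam / 2 * S h.
  move=> Yh; have d x : Y <= x -> is_derive x 1 (fun x => q x - lam / 2 * S x)
      (dq x - lam / 2 * (2 * (s * u x))).
    by move=> Yx; exact: is_derive_sub (qd x Yx) (is_derive_mull _ (Sd x)).
  apply: (is_derive_ndecr d _ (lexx Y) Yh) => x /dq_bounds /andP[b _]; lra.
have lower h : Y <= h -> q h - lam * S h <= q Y - lam * S Y.
  move=> Yh; have d x : Y <= x -> is_derive x 1 (fun x => q x - lam * S x)
      (dq x - lam * (2 * (s * u x))).
    by move=> Yx; exact: is_derive_sub (qd x Yx) (is_derive_mull _ (Sd x)).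
  apply: (is_derive_nincr d _ (lexx Y) Yh) => x /dq_bounds /andP[_ b]; lra.
pose k := `|q Y| + lam * `|S Y|.
have k0 : 0 <= k by rewrite addr_ge0// mulr_ge0// ltW.
have ck : 0 < c / (2 * k + 1) by rewrite divr_gt0// ltr_wpDl// mulr_ge0.
have [Y3 Y31 hY3] := powR_eventually_small gamma_gt0 ck.
exists (c / (4 * lam)), (3 * C / (2 * lam)), (Y + Y3).
split; [by rewrite divr_gt0// mulr_gt0|by rewrite divr_gt0// mulr_gt0|move=> h Kh].
have Yh : Y <= h by lra.
have h0 := Ypos h Yh.
have Xh : X <= h by move: Yh; rewrite /Y; lra.
have [su /andP[b1 b2] _ _] := G h Xh.
have hg : 0 < h `^ gamma by rewrite powR_gt0.
have qk : 2 * k <= q h.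
  have : h `^ (- gamma) <= c / (2 * k + 1) by apply: hY3; lra.
  rewrite powRN ler_pdivlMr ?ltr_wpDl ?mulr_ge0// mulrC ler_pdivrMr// => h1.
  apply: le_trans (_ : c * h `^ gamma <= _); first by lra.
  rewrite mulrC /q ler_pM2l// (le_trans _ b1)// ler_peMr ?(ltW c0)//.
  rewrite -[X in X <= _]expR0 ler_expR mulr_ge0 ?(ltW lam_gt0)//.
  by rewrite divr_ge0 ?powR_ge0 ?(ltW g1).
have SE : P h - P (- h) = s * S h.
  by rewrite /S mulrA -expr2 s2 mul1r mulN1r.
have s1 := sqr_eq1_norm s2.
have kq := ler_norm (q Y); have kq' := ler_norm (- q Y); rewrite normrN in kq'.
have kS : lam * S Y <= lam * `|S Y| by rewrite ler_pM2l// ler_norm.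
have kS' : - (lam * S Y) <= lam * `|S Y|.
  by rewrite -mulrN ler_pM2l// -normrN ler_norm.
have lS : 0 <= lam * `|S Y| by rewrite mulr_ge0// ltW.
have Slo : q h / (2 * lam) <= S h.
  rewrite ler_pdivrMr ?mulr_gt0//; have := lower h Yh; move: qk; rewrite /k; lra.
have Sup : S h <= 3 * q h / lam.
  rewrite ler_pdivlMr//; have := upper h Yh; move: qk; rewrite /k.
  have := normr_ge0 (q Y); lra.
have qh0 : 0 <= q h by rewrite mulr_ge0 ?ltW.
have S0 : 0 <= S h by rewrite (le_trans _ Slo)// divr_ge0// mulr_ge0// ltW.
have hE : h `^ gamma = h * h `^ (gamma - 1).
  rewrite -{2}[h]powRr1 ?(ltW h0)// -powRD; last by rewrite (gt_eqF h0) implybT.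
  by congr (_ `^ _); ring.
rewrite SE normrM normrM s1 mul1r (ger0_norm S0).
rewrite gtr0_norm ?invr_gt0 ?mulr_gt0//.
have hg1 : 0 < h `^ (gamma - 1) by rewrite powR_gt0.
rewrite ler_pdivlMr ?mulr_gt0// ler_pdivrMr ?mulr_gt0//.
set E := expR _ in b1 b2 *.
apply/andP; split.
  apply: le_trans Slo; rewrite ler_pdivlMr ?mulr_gt0//.
  rewrite [leLHS](_ : _ = h * h `^ (gamma - 1) * (c * E)); last by field; rewrite gt_eqF.
  by rewrite /q hE ler_pM2l ?mulr_gt0.
apply: le_trans Sup _; rewrite ler_pdivrMr//.
rewrite [leRHS](_ : _ = 3 * (h * h `^ (gamma - 1) * (C * E)));
  last by field; rewrite gt_eqF.
by rewrite ler_pM2l// /q hE ler_pM2l ?mulr_gt0.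
Qed.

End WindowMeans.

(** * Relaxation times of a family of exponentials *)

Section TimeScales.
Context {R : realType}.

Lemma decay_time_iff (lam r q t : R) : 0 < lam -> 0 < r -> q != 0 ->
  expR (- 2 * (lam / r) * t) * q ^+ 2 = 1 <-> t = r / lam * ln `|q|.
Proof.
move=> lam0 r0 q0; have nq : 0 < `|q| by rewrite normr_gt0.
have -> : q ^+ 2 = expR (2 * ln `|q|).
  by rewrite mulrC expRM_natr lnK// real_normK// num_real.
rewrite -expRD -[X in _ = X <-> _]expR0; split=> [/expR_inj E|->].
  apply: (mulfI (_ : 2 * (lam / r) != 0)).
    by rewrite gt_eqF// !mulr_gt0// invr_gt0.
  transitivity (2 * ln `|q|); first by lra.
  by field; rewrite !gt_eqF.
by congr expR; field; rewrite !gt_eqF.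
Qed.

Lemma decay_time_bounds (lam r g Z A B q : R) :
  0 < lam -> 0 < r -> 0 < A -> 0 < B ->
  A * expR (g + lam * Z) <= `|q| <= B * expR (g + lam * Z) ->
  r / lam * (g + ln A) + r * Z <= r / lam * ln `|q|
    <= r / lam * (g + ln B) + r * Z.
Proof.
move=> lam0 r0 A0 B0 /andP[Aq qB].
have rl : 0 < r / lam by rewrite divr_gt0.
have E K : r / lam * (g + K) + r * Z = r / lam * (K + (g + lam * Z)).
  by field; rewrite gt_eqF.
have eA K : 0 < K -> ln (K * expR (g + lam * Z)) = ln K + (g + lam * Z).
  by move=> K0; rewrite lnM ?posrE ?expR_gt0// expRK.
have q0 : 0 < `|q| by rewrite (lt_le_trans _ Aq)// mulr_gt0 ?expR_gt0.
by rewrite !E !ler_pM2l// -!eA// !ler_ln ?posrE ?mulr_gt0 ?expR_gt0// Aq.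
Qed.

(** At the time when mode [lam] has relaxed to size 1, mode [lamk] has size
    [exp ((1 - lamk / lam) g)] up to constants: the contributions of [Z]
    cancel exactly. *)
Lemma decayed_term_le (lam lamk r g Z A B q qk t : R) :
  0 < lam -> 0 <= lamk -> 0 < r -> 0 < A -> 0 < B ->
  (1 - lamk / lam) * g <= 0 ->
  A * expR (g + lam * Z) <= `|q| -> `|qk| <= B * expR (g + lamk * Z) ->
  t = r / lam * ln `|q| ->
  expR (- 2 * (lamk / r) * t) * qk ^+ 2 <= B ^+ 2 * expR (- 2 * (lamk / lam) * ln A).
Proof.
move=> lam0 lamk0 r0 A0 B0 g0 Aq qB tE.
have q0 : 0 < `|q| by rewrite (lt_le_trans _ Aq)// mulr_gt0 ?expR_gt0.
have lq : ln A + (g + lam * Z) <= ln `|q|.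
  by rewrite -[g + _]expRK -lnM ?posrE ?expR_gt0// ler_ln ?posrE ?mulr_gt0 ?expR_gt0.
have q2 : qk ^+ 2 <= B ^+ 2 * expR (2 * (g + lamk * Z)).
  rewrite -[qk ^+ 2]real_normK ?num_real// [X in expR X]mulrC expRM_natr -exprMn.
  by rewrite lerXn2r// nnegrE// mulr_ge0 ?expR_ge0// ltW.
apply: le_trans (_ : expR (- 2 * (lamk / r) * t) *
    (B ^+ 2 * expR (2 * (g + lamk * Z))) <= _).
  by rewrite ler_wpM2l ?expR_ge0.
rewrite mulrCA ler_pM2l ?exprn_gt0// -expRD ler_expR tE.
have -> : - 2 * (lamk / r) * (r / lam * ln `|q|) = - (2 * (lamk / lam) * ln `|q|).
  by field; rewrite !gt_eqF.
have th : 0 <= 2 * (lamk / lam) by rewrite mulr_ge0// divr_ge0// ltW.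
have := ler_wpM2l th lq.
have -> : 2 * (lamk / lam) * (ln A + (g + lam * Z)) =
   2 * (lamk / lam) * ln A + 2 * (lamk / lam * g) + 2 * (lamk * Z).
  by field; rewrite gt_eqF.
by lra.
Qed.

Lemma near_sum_bounded (T : Type) (F : set_system R) (FF : Filter F)
    (Q : R -> T -> Prop) (f : nat -> R -> T -> R) (n : nat) :
  (forall k, (1 <= k <= n)%N -> exists2 M, 0 <= M &
     \forall eps \near F, forall t, Q eps t -> f k eps t <= M) ->
  exists2 M, 0 <= M & \forall eps \near F, forall t, Q eps t ->
     \sum_(1 <= k < n.+1) f k eps t <= M.
Proof.
elim: n => [_|n IH fM].
  by exists 0 => //; near=> eps => t _; rewrite big_geq.
have [k /andP[k1 kn]|M M0 hM] := IH; first by apply: fM; rewrite k1 leqW.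
have [//|M' M'0 hM'] := fM n.+1; first by rewrite leqnn.
exists (M + M'); first by rewrite addr_ge0.
near=> eps => t Qt; rewrite big_nat_recr//= lerD//.
  by move: t Qt; near: eps.
by move: t Qt; near: eps.
Unshelve. all: by end_near. Qed.

(** The common mechanism of the two regimes: up to constants,
    every nonzero coefficient is bounded by [exp (g + lam k * Z)], and that of
    the reference mode [m] is of this size. *)
Variables (n m : nat) (lam : nat -> R) (q : nat -> R -> R) (g Z r : R -> R).
Hypothesis mn : (1 <= m <= n)%N.
Hypothesis lam_gt0 : forall k, (1 <= k)%N -> 0 < lam k.
Hypothesis r_gt0 : \forall eps \near 0^'+, 0 < r eps.
Hypothesis growth : forall M, \forall eps \near 0^'+, M <= g eps + lam m * Z eps.
Hypothesis qm : exists A B, [/\ 0 < A, 0 < B & \forall eps \near 0^'+,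
  A * expR (g eps + lam m * Z eps) <= `|q m eps|
    <= B * expR (g eps + lam m * Z eps)].
Hypothesis qk : forall k, (1 <= k <= n)%N ->
  (\forall eps \near 0^'+, q k eps = 0) \/
  exists2 B, 0 < B & \forall eps \near 0^'+,
    (1 - lam k / lam m) * g eps <= 0 /\
    `|q k eps| <= B * expR (g eps + lam k * Z eps).

Let is_time eps t := expR (- 2 * (lam m / r eps) * t) * q m eps ^+ 2 = 1.
Let dist eps t := Num.sqrt (\sum_(1 <= k < n.+1)
  expR (- 2 * (lam k / r eps) * t) * q k eps ^+ 2).

Let lamm : 0 < lam m. Proof. by apply: lam_gt0; case/andP: mn. Qed.

Lemma decay_time_exists_unique :
  \forall eps \near 0^'+, exists2 t, 0 <= t & unique (is_time eps) t.
Proof.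
have [A [B [A0 B0 AB]]] := qm.
near=> eps.
have r0 : 0 < r eps by near: eps.
have /andP[Aq _] : A * expR (g eps + lam m * Z eps) <= `|q m eps|
    <= B * expR (g eps + lam m * Z eps) by near: eps.
have q0 : 0 < `|q m eps| by rewrite (lt_le_trans _ Aq)// mulr_gt0 ?expR_gt0.
have gr : ln A^-1 <= g eps + lam m * Z eps by near: eps; exact: growth.
have q1 : 1 <= `|q m eps|.
  apply: le_trans Aq; rewrite -ler_pdivrMl// mulr1.
  by rewrite -[leLHS]lnK ?posrE ?invr_gt0// ler_expR.
have TE t : is_time eps t <-> t = r eps / lam m * ln `|q m eps|.
  by apply: decay_time_iff => //; rewrite -normr_gt0.
exists (r eps / lam m * ln `|q m eps|).
  by rewrite mulr_ge0 ?ln_ge0// divr_ge0// ltW.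
by split; [apply/TE|move=> t /TE].
Unshelve. all: by end_near. Qed.

Lemma decay_time_asymptotics :
  exists2 C, 1 <= C & \forall eps \near 0^'+, forall t, is_time eps t ->
    r eps / lam m * (g eps - ln C) + r eps * Z eps <= t
    <= r eps / lam m * (g eps + ln C) + r eps * Z eps.
Proof.
have [A [B [A0 B0 AB]]] := qm.
pose C := 1 + A^-1 + B.
have iA0 : 0 < A^-1 by rewrite invr_gt0.
have C0 : 0 < C by rewrite /C; lra.
exists C; first by rewrite /C; lra.
near=> eps => t.
have r0 : 0 < r eps by near: eps.
have ABq : A * expR (g eps + lam m * Z eps) <= `|q m eps|
    <= B * expR (g eps + lam m * Z eps) by near: eps.
have q0 : 0 < `|q m eps|.
  by case/andP: ABq => Aq _; rewrite (lt_le_trans _ Aq)// mulr_gt0 ?expR_gt0.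
have qn0 : q m eps != 0 by rewrite -normr_gt0.
move=> /(decay_time_iff _ lamm r0 qn0) ->.
have /andP[b1 b2] := decay_time_bounds lamm r0 A0 B0 ABq.
have rl : 0 < r eps / lam m by rewrite divr_gt0.
have lA : - ln C <= ln A.
  rewrite -lnV ?posrE// ler_ln ?posrE ?invr_gt0// invf_ple ?posrE//.
  by rewrite /C; lra.
have lB : ln B <= ln C by rewrite ler_ln ?posrE//; rewrite /C; lra.
apply/andP; split.
  by apply: le_trans b1; rewrite lerD2r ler_pM2l// lerD2l.
by apply: le_trans b2 _; rewrite lerD2r ler_pM2l// lerD2l.
Unshelve. all: by end_near. Qed.

Lemma dist_at_decay_time :
  exists2 C, 1 <= C & \forall eps \near 0^'+, forall t, is_time eps t ->
    C^-1 <= dist eps t <= C.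
Proof.
have [A [B [A0 B0 AB]]] := qm.
have [k kn|M M0 hM] := @near_sum_bounded R 0^'+ _ is_time
  (fun k eps t => expR (- 2 * (lam k / r eps) * t) * q k eps ^+ 2) n.
  have lamk : 0 < lam k by apply: lam_gt0; case/andP: kn.
  have [qk0|[Bk Bk0 hBk]] := qk kn.
    exists 0 => //; near=> eps => t _; rewrite (_ : q k eps = 0); last by near: eps.
    by rewrite expr0n mulr0.
  exists (Bk ^+ 2 * expR (- 2 * (lam k / lam m) * ln A)).
    by rewrite mulr_ge0 ?sqr_ge0 ?expR_ge0.
  near=> eps => t tE.
  have r0 : 0 < r eps by near: eps.
  have /andP[Aq _] : A * expR (g eps + lam m * Z eps) <= `|q m eps|
    <= B * expR (g eps + lam m * Z eps) by near: eps.
  have q0 : 0 < `|q m eps| by rewrite (lt_le_trans _ Aq)// mulr_gt0 ?expR_gt0.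
  have qn0 : q m eps != 0 by rewrite -normr_gt0.
  have [g0 qB] : (1 - lam k / lam m) * g eps <= 0 /\
    `|q k eps| <= Bk * expR (g eps + lam k * Z eps) by near: eps.
  apply: (decayed_term_le lamm (ltW lamk) r0 A0 Bk0 g0 Aq qB).
  exact/(decay_time_iff _ lamm r0 qn0).
exists (1 + M); first by rewrite lerDl.
near=> eps => t tE; apply/andP; split.
  apply: le_trans (_ : 1 <= _); first by rewrite invf_le1 ?lerDl// ltr_pwDl.
  rewrite -[X in X <= _]sqrtr1 ler_wsqrtr// -[X in X <= _]tE.
  rewrite (big_rem m)/=; last by rewrite mem_index_iota.
  by rewrite lerDl sumr_ge0// => k _; rewrite mulr_ge0 ?expR_ge0 ?sqr_ge0.
have S1 : \sum_(1 <= k < n.+1)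
  expR (- 2 * (lam k / r eps) * t) * q k eps ^+ 2 <= M.
  by move: t tE; near: eps.
rewrite /dist -[leRHS]ger0_norm ?addr_ge0// -sqrtr_sqr ler_wsqrtr//.
by apply: le_trans S1 _; nra.
Unshelve. all: by end_near. Qed.

End TimeScales.

(** * The small-noise regime *)

Lemma bigmax_mem (s : seq nat) : s <> [::] -> (\max_(j <- s) j)%N \in s.
Proof.
case: s => // a s _; elim: s a => [|b s IH] a.
  by rewrite big_seq1 mem_head.
rewrite big_cons; case: (leqP a (\max_(j <- b :: s) j)) => _.
  by rewrite inE IH orbT.
by rewrite mem_head.
Qed.

Section SmallNoise.
Context {R : realType}.

Lemma near0_powRN_ge (p K : R) : 0 < p -> \forall eps \near 0^'+, K <= eps `^ (- p).
Proof.
move=> p0; pose k := `|K| + 1; have k0 : 0 < k by rewrite ltr_wpDl.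
have d0 : 0 < k `^ (- p^-1) by rewrite powR_gt0.
near=> eps.
have e0 : 0 < eps by near: eps; exact: nbhs_right_gt.
have ed : eps <= k `^ (- p^-1) by near: eps; exact: nbhs_right_le.
apply: le_trans (_ : k <= _).
  by rewrite (le_trans (ler_norm _))// lerDl.
have -> : k = (k `^ (- p^-1)) `^ (- p).
  by rewrite -powRrM mulrNN mulVf ?gt_eqF// powRr1// ltW.
rewrite (powRN eps) (powRN (k `^ _)) lef_pV2 ?posrE ?powR_gt0//.
by apply: ge0_ler_powR; rewrite ?nnegrE ?(ltW p0) ?(ltW e0) ?(ltW d0).
Unshelve. all: by end_near. Qed.

Implicit Types (eps x K M : R) (k : nat) (v P : R -> R).

Variables (gamma : R) (l : R -> nat -> R) (psi : R -> nat -> R -> R).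
Hypothesis gamma_gt13 : 1 / 3 < gamma.
Hypothesis gamma_lt1 : gamma < 1.
Hypothesis hspec : forall eps : R, 0 < eps -> eps <= 1 ->
  spectral_system gamma eps (l eps) (psi eps).

Let gamma_gt0 : 0 < gamma. Proof. by move: gamma_gt13; lra. Qed.
Let spec1 : spectral_system gamma 1 (l 1) (psi 1).
Proof. by apply: hspec; rewrite ?ltr01. Qed.
Let gamma1_neq0 : 1 + gamma != 0.
Proof. by rewrite gt_eqF// addr_gt0. Qed.

(** The factor of the change of variables that brings the noise level to 1; the
    radius of the initial density becomes [zoom eps `^ gamma]. *)
Definition zoom (eps : R) : R := eps `^ (- (1 + gamma)^-1).

Lemma zoom_gt0 eps : 0 < eps -> 0 < zoom eps.
Proof. by move=> e0; rewrite powR_gt0. Qed.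

Lemma radius_gt0 eps : 0 < eps -> 0 < Defs.radius gamma eps.
Proof. by move=> e0; rewrite powR_gt0. Qed.

Lemma radiusV eps : eps `^ ((gamma - 1) / (1 + gamma)) = (Defs.radius gamma eps)^-1.
Proof. by rewrite -powRN -mulNr opprB. Qed.

Lemma zoom_pow1B eps : zoom eps `^ (1 - gamma) = (Defs.radius gamma eps)^-1.
Proof. by rewrite -radiusV -powRrM; congr (_ `^ _); field. Qed.

Lemma zoom_radius eps : 0 < eps -> zoom eps * Defs.radius gamma eps = zoom eps `^ gamma.
Proof.
move=> e0; rewrite -powRrM -powRD; last by rewrite (gt_eqF e0) implybT.
by congr (_ `^ _); field.
Qed.

Lemma near0_zoom_ge K : \forall eps \near 0^'+, K <= zoom eps.
Proof. by apply: near0_powRN_ge; rewrite invr_gt0 addr_gt0. Qed.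

Lemma near0_zoom_pow_ge K : \forall eps \near 0^'+, K <= zoom eps `^ gamma.
Proof.
rewrite /zoom; under eq_near do rewrite -powRrM mulNr.
by apply: near0_powRN_ge; rewrite mulr_gt0// invr_gt0 addr_gt0.
Qed.

Lemma eigenvalue_gt0 k : (1 <= k)%N -> 0 < l 1 k.
Proof.
by move=> k1; have [[l0 _ li] _ _ _ _] := spec1; rewrite -l0; exact: li.
Qed.

Lemma spectral_zoom eps k : 0 < eps -> eps <= 1 ->
  l eps k = l 1 k / Defs.radius gamma eps /\
  exists2 s : R, s ^+ 2 = 1 & forall x, psi eps k x = s * psi 1 k (zoom eps * x).
Proof.
move=> e0 e1; have z0 := zoom_gt0 e0.
have h : `|zoom eps| `^ (gamma + 1) * eps = 1.
  rewrite gtr0_norm// -powRrM mulNr [gamma + 1]addrC mulVf// powR_inv1 ?(ltW e0)//.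
  by rewrite mulVf// gt_eqF.
have := spectral_system_scale gamma_gt0 (lt0r_neq0 z0) e0 ltr01 h (hspec e0 e1) spec1 k.
by rewrite gtr0_norm// zoom_pow1B.
Qed.

Lemma initial_coef_zoom eps x0 k P : 0 < eps -> eps <= 1 ->
  (forall x : R, is_derive x 1 P (psi 1 k x)) ->
  `|initial_coef gamma eps x0 (psi eps k)| =
  `|(P (zoom eps * x0 + zoom eps `^ gamma) - P (zoom eps * x0 - zoom eps `^ gamma))
     / (2 * zoom eps `^ gamma)|.
Proof.
move=> e0 e1 Pd; have z0 := zoom_gt0 e0; have r0 := radius_gt0 e0.
have [_ [s s2 psiE]] := spectral_zoom k e0 e1.
have [_ _ ef _ _] := hspec e0 e1.
have pc := eigenfunction_continuous (ef k).
have Qd (x : R) : is_derive x 1 (fun x => s / zoom eps * P (zoom eps * x)) (psi eps k x).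
  apply: (is_derive_eq (is_derive_mull _ (is_derive_scale_arg (Pd (zoom eps * x))))).
  by rewrite psiE; field; rewrite gt_eqF.
have ab : x0 - Defs.radius gamma eps < x0 + Defs.radius gamma eps by rewrite ltrD2l; lra.
rewrite /initial_coef /initial_density (Rintegral_indic_itvoo _ pc Qd ab).
rewrite -zoom_radius// [zoom eps * (x0 + _)]mulrDr [zoom eps * (x0 - _)]mulrBr.
set D := P _ - _.
have s1 := sqr_eq1_norm s2.
transitivity `|s * (D / (2 * (zoom eps * Defs.radius gamma eps)))|.
  by congr `| _ |; rewrite /D; field; rewrite !gt_eqF.
by rewrite normrM s1 mul1r.
Qed.

Lemma eigenfunction1_data k : exists (v P : R -> R) (sg : R),
  [/\ eigen_ode gamma (l 1 k) (psi 1 k) v, (exists x, psi 1 k x != 0),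
     (forall x : R, is_derive x 1 P (psi 1 k x)), sg ^+ 2 = 1 &
     forall x, psi 1 k x = sg * psi 1 k (-1 * x)].
Proof.
have [_ _ ef _ _] := spec1; have efk := ef k.
have [P Pd] := continuous_antiderivative (eigenfunction_continuous efk).
have [sg sg2 sgE] := spectral_system_parity gamma_gt0 ltr01 spec1 k.
exists ((psi 1 k)^`())%classic, P, sg; split => //.
  exact: eigenfunction_ode.
by have [_ ? _ _ _] := efk.
Qed.

Lemma eigenfunction1_growth k v : (1 <= k)%N ->
  eigen_ode gamma (l 1 k) (psi 1 k) v -> (exists x, psi 1 k x != 0) ->
  exists s X c C : R, [/\ s ^+ 2 = 1, 1 <= X, 0 < c, 0 < C &
    recessive_growth gamma (l 1 k) (psi 1 k) v s X c C].
Proof.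
move=> k1 uv unz.
have [G [M [Gd GM]]] := spectral_system_antiderivative_bound gamma_gt0 k spec1.
exact: (eigen_ode_asymptotics gamma_gt13 gamma_lt1 (eigenvalue_gt0 k1) uv unz Gd GM).
Qed.

Lemma initial_coef_away k x0 : (1 <= k)%N -> x0 != 0 ->
  exists A B, [/\ 0 < A, 0 < B & \forall eps \near 0^'+,
    A * expR (0 + l 1 k * ((zoom eps * `|x0|) `^ (1 - gamma) / (1 - gamma)))
      <= `|initial_coef gamma eps x0 (psi eps k)|
    <= B * expR (0 + l 1 k * ((zoom eps * `|x0|) `^ (1 - gamma) / (1 - gamma)))].
Proof.
move=> k1 x00; have [v [P [sg [uv unz Pd sg2 sgE]]]] := eigenfunction1_data k.
have [s [X [c [C [s2 _ c0 C0 G]]]]] := eigenfunction1_growth k1 uv unz.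
have [A [B [K [A0 B0 AB]]]] := window_mean_away gamma_gt0 gamma_lt1
  (eigenvalue_gt0 k1) s2 c0 C0 G (parity_norm sg2 sgE) Pd x00.
exists A, B; split => //; near=> eps; rewrite add0r.
have e0 : 0 < eps by near: eps; exact: nbhs_right_gt.
have e1 : eps <= 1 by near: eps; exact: nbhs_right_le.
rewrite (initial_coef_zoom _ e0 e1 Pd); apply: AB.
by near: eps; exact: near0_zoom_ge.
Unshelve. all: by end_near. Qed.

Lemma zoom_window_prefactor eps : 0 < eps ->
  zoom eps `^ gamma `^ (gamma - 1) =
  expR (gamma * (1 - gamma) / (1 + gamma) * ln eps).
Proof.
move=> e0; rewrite -2!powRrM.
have -> : - (1 + gamma)^-1 * (gamma * (gamma - 1)) =
    gamma * (1 - gamma) / (1 + gamma) by field; exact: gamma1_neq0.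
by rewrite /powR (gt_eqF e0).
Qed.

Lemma initial_coef_center k : (1 <= k)%N -> psi 1 k 0 != 0 ->
  exists A B, [/\ 0 < A, 0 < B & \forall eps \near 0^'+,
    A * expR (gamma * (1 - gamma) / (1 + gamma) * ln eps
        + l 1 k * ((zoom eps `^ gamma) `^ (1 - gamma) / (1 - gamma)))
      <= `|initial_coef gamma eps 0 (psi eps k)|
    <= B * expR (gamma * (1 - gamma) / (1 + gamma) * ln eps
        + l 1 k * ((zoom eps `^ gamma) `^ (1 - gamma) / (1 - gamma)))].
Proof.
move=> k1 u0; have [v [P [sg [uv unz Pd sg2 sgE]]]] := eigenfunction1_data k.
have [s [X [c [C [s2 X1 c0 C0 G]]]]] := eigenfunction1_growth k1 uv unz.
have ueven x : psi 1 k (-1 * x) = psi 1 k x.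
  by rewrite (eigen_ode_parity_at0 gamma_gt0 uv unz sg2 sgE) (negbTE u0).
have [A [B [K [A0 B0 AB]]]] := window_mean_center gamma_gt0 gamma_lt1
  (eigenvalue_gt0 k1) s2 X1 c0 C0 G uv.1 ueven Pd.
exists A, B; split => //; near=> eps.
have e0 : 0 < eps by near: eps; exact: nbhs_right_gt.
have e1 : eps <= 1 by near: eps; exact: nbhs_right_le.
rewrite (initial_coef_zoom _ e0 e1 Pd) mulr0 add0r sub0r expRD -zoom_window_prefactor//.
by apply: AB; near: eps; exact: near0_zoom_pow_ge.
Unshelve. all: by end_near. Qed.

Lemma initial_coef_center_eq0 k eps : psi 1 k 0 = 0 -> 0 < eps -> eps <= 1 ->
  initial_coef gamma eps 0 (psi eps k) = 0.
Proof.
move=> u0 e0 e1; have [v [P [sg [uv unz Pd sg2 sgE]]]] := eigenfunction1_data k.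
apply/eqP; rewrite -normr_eq0 (initial_coef_zoom _ e0 e1 Pd) mulr0 add0r sub0r.
rewrite (odd_window_mean0 _ Pd) ?mul0r ?normr0// => x.
by rewrite (eigen_ode_parity_at0 gamma_gt0 uv unz sg2 sgE) u0 eqxx.
Qed.

Lemma growth_away k x0 M : (1 <= k)%N -> x0 != 0 -> \forall eps \near 0^'+,
  M <= 0 + l 1 k * ((zoom eps * `|x0|) `^ (1 - gamma) / (1 - gamma)).
Proof.
move=> k1 x00; have g1 : 0 < 1 - gamma by rewrite subr_gt0.
have l0 := eigenvalue_gt0 k1.
have x0g : 0 < `|x0| `^ (1 - gamma) by rewrite powR_gt0 ?normr_gt0.
near=> eps.
have e0 : 0 < eps by near: eps; exact: nbhs_right_gt.
rewrite add0r powRM ?(ltW (zoom_gt0 e0))//.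
rewrite mulrA ler_pdivlMr// mulrA -ler_pdivrMr// -ler_pdivrMl//.
rewrite zoom_pow1B -radiusV (_ : (gamma - 1) / _ = - ((1 - gamma) / (1 + gamma)));
  last by rewrite -mulNr opprB.
by near: eps; apply: near0_powRN_ge; rewrite divr_gt0// addr_gt0.
Unshelve. all: by end_near. Qed.

(** The prefactor is [y^-1] with [y = zoom eps `^ (gamma * (1 - gamma))], so
    the exponent is [l y / (1 - gamma) - ln y]; the logarithm is absorbed by
    half of the linear term. *)
Lemma growth_center k M : (1 <= k)%N -> \forall eps \near 0^'+,
  M <= gamma * (1 - gamma) / (1 + gamma) * ln eps
    + l 1 k * ((zoom eps `^ gamma) `^ (1 - gamma) / (1 - gamma)).
Proof.
move=> k1; have g1 : 0 < 1 - gamma by rewrite subr_gt0.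
have l0 := eigenvalue_gt0 k1.
pose kap := l 1 k / (1 - gamma) / 2.
have kap0 : 0 < kap by rewrite !divr_gt0.
near=> eps.
have e0 : 0 < eps by near: eps; exact: nbhs_right_gt.
pose y := zoom eps `^ gamma `^ (1 - gamma).
have y0 : 0 < y by rewrite !powR_gt0.
have lny : gamma * (1 - gamma) / (1 + gamma) * ln eps = - ln y.
  by rewrite -[LHS]expRK -zoom_window_prefactor// -opprB powRN lnV ?posrE.
have ybig : (M - ln kap) / kap <= y.
  rewrite /y /zoom -2!powRrM !mulNr.
  near: eps; apply: near0_powRN_ge.
  by rewrite !mulr_gt0// invr_gt0 addr_gt0.
rewrite lny -/y.
have : ln (kap * y) <= kap * y by apply: ltW; apply: ln_sublinear; rewrite mulr_gt0.
rewrite lnM ?posrE// => lk.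
move: ybig; rewrite ler_pdivrMr// => ybig.
have -> : l 1 k * (y / (1 - gamma)) = 2 * (kap * y).
  by rewrite /kap; field; rewrite gt_eqF.
by lra.
Unshelve. all: by end_near. Qed.

Lemma chi2_dist_zoom n eps t x0 : 0 < eps -> eps <= 1 ->
  chi2_dist gamma eps (l eps) (psi eps) n t x0 =
  Num.sqrt (\sum_(1 <= k < n.+1) expR (- 2 * (l 1 k / Defs.radius gamma eps) * t)
    * initial_coef gamma eps x0 (psi eps k) ^+ 2).
Proof.
move=> e0 e1; congr Num.sqrt; apply: eq_bigr => k _.
by have [-> _] := spectral_zoom k e0 e1.
Qed.

Lemma chi2_dist1_eq1 eps t x0 : 0 < eps -> eps <= 1 ->
  chi2_dist gamma eps (l eps) (psi eps) 1 t x0 = 1 <->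
  expR (- 2 * (l 1 1%N / Defs.radius gamma eps) * t)
    * initial_coef gamma eps x0 (psi eps 1%N) ^+ 2 = 1.
Proof.
move=> e0 e1; rewrite chi2_dist_zoom// big_nat1.
split=> [E|->]; last by rewrite sqrtr1.
rewrite -[LHS]sqr_sqrtr ?E ?expr1n//.
by rewrite mulr_ge0 ?expR_ge0 ?sqr_ge0.
Qed.

Let near0_01 : \forall eps \near 0^'+, 0 < eps :> R /\ eps <= 1.
Proof.
near=> eps; split; first by near: eps; exact: nbhs_right_gt.
by near: eps; exact: nbhs_right_le.
Unshelve. all: by end_near. Qed.

Let near0_radius_gt0 : \forall eps \near 0^'+, 0 < Defs.radius gamma eps.
Proof. by near=> eps; apply: radius_gt0; near: eps; exact: nbhs_right_gt.
Unshelve. all: by end_near. Qed.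

(** Here [g = 0] and the first mode is the reference: all modes carry the same
    factor [Z], and hence relax at the same time. *)
Lemma relaxation_away x0 : x0 != 0 ->
  let d n eps t := chi2_dist gamma eps (l eps) (psi eps) n t x0 in
  [/\ \forall eps \near 0^'+,
        exists2 t : R, 0 <= t & unique (fun s : R => d 1%N eps s = 1) t,
      forall n : nat, (1 <= n)%N ->
        exists2 C : R, 1 <= C & \forall eps \near 0^'+, forall t : R,
          d 1%N eps t = 1 -> C^-1 <= d n eps t <= C &
      exists2 C : R, 1 <= C & \forall eps \near 0^'+, forall t : R,
        d 1%N eps t = 1 ->
        ln (1 / C) / l 1 1%N * eps `^ ((1 - gamma) / (1 + gamma))
          + `|x0| `^ (1 - gamma) / (1 - gamma) <= t
        <= ln C / l 1 1%N * eps `^ ((1 - gamma) / (1 + gamma))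
          + `|x0| `^ (1 - gamma) / (1 - gamma)].
Proof.
move=> x00 d.
pose q k eps := initial_coef gamma eps x0 (psi eps k).
pose Z eps := (zoom eps * `|x0|) `^ (1 - gamma) / (1 - gamma).
have q1 := initial_coef_away (leqnn 1) x00.
have gr M := growth_away M (leqnn 1) x00.
have n1 n : (1 <= n)%N -> (1 <= 1 <= n)%N by [].
have qk n k : (1 <= k <= n)%N -> (\forall eps \near 0^'+, q k eps = 0) \/
    exists2 B, 0 < B & \forall eps \near 0^'+,
      (1 - l 1 k / l 1 1%N) * 0 <= 0 /\ `|q k eps| <= B * expR (0 + l 1 k * Z eps).
  move=> /andP[k1 _]; right.
  have [A [B [_ B0 AB]]] := initial_coef_away k1 x00.
  exists B => //; near=> eps; rewrite mulr0; split => //.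
  by have /andP[] : A * expR (0 + l 1 k * Z eps) <= `|q k eps|
    <= B * expR (0 + l 1 k * Z eps) by near: eps.
split.
- have T := decay_time_exists_unique (n := 1)
    (q := q) (g := fun=> 0) (Z := Z) (r := Defs.radius gamma)
    (n1 1%N isT) eigenvalue_gt0
    near0_radius_gt0 gr q1.
  move: near0_01 T; apply: filterS2 => eps [e0 e1] [t t0 [tE tu]].
  exists t => //; split; first exact/(chi2_dist1_eq1 _ _ e0 e1).
  by move=> s /(chi2_dist1_eq1 _ _ e0 e1) /tu.
- move=> n n_gt0.
  have [C C1 hC] := dist_at_decay_time
    (q := q) (g := fun=> 0) (Z := Z) (r := Defs.radius gamma)
    (n1 n n_gt0) eigenvalue_gt0
    near0_radius_gt0 q1 (qk n).
  exists C => //; near=> eps => t.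
  have [e0 e1] : 0 < eps /\ eps <= 1 by near: eps.
  move/(chi2_dist1_eq1 _ _ e0 e1) => tE.
  rewrite /d (chi2_dist_zoom n t x0 e0 e1).
  by move: t tE; near: eps.
- have [C C1 hC] := decay_time_asymptotics (n := 1)
    (q := q) (g := fun=> 0) (Z := Z) (r := Defs.radius gamma)
    (n1 1%N isT) eigenvalue_gt0
    near0_radius_gt0 q1.
  exists C => //; near=> eps => t.
  have [e0 e1] : 0 < eps /\ eps <= 1 by near: eps.
  have C0 : 0 < C by rewrite (lt_le_trans _ C1).
  have r0 := radius_gt0 e0.
  have zE : Defs.radius gamma eps * Z eps = `|x0| `^ (1 - gamma) / (1 - gamma).
    rewrite /Z powRM ?(ltW (zoom_gt0 e0))// zoom_pow1B mulrA mulrA mulfV ?mul1r//.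
    by rewrite gt_eqF.
  move/(chi2_dist1_eq1 _ _ e0 e1) => tE.
  have : Defs.radius gamma eps / l 1 1%N * (0 - ln C) + Defs.radius gamma eps * Z eps <= t
    <= Defs.radius gamma eps / l 1 1%N * (0 + ln C) + Defs.radius gamma eps * Z eps.
    by move: t tE; near: eps.
  rewrite zE sub0r add0r -/(Defs.radius gamma eps) div1r lnV ?posrE//.
  have E (x : R) : x / l 1 1%N * Defs.radius gamma eps =
    Defs.radius gamma eps / l 1 1%N * x by ring.
  by rewrite !E.
Unshelve. all: by end_near. Qed.

Lemma nonvanishing_indicesP n k :
  reflect ((1 <= k <= n)%N /\ psi 1 k 0 != 0) (k \in nonvanishing_indices (psi 1) n).
Proof.
by rewrite mem_filter mem_index_iota ltnS; apply: (iffP andP) => -[].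
Qed.

(** The prefactor [exp g] is smaller than 1 and common to all the modes that do
    not vanish at 0; the slowest to reach size 1 is therefore the one with the
    largest eigenvalue, which explains the choice of [m]. *)
Lemma relaxation_center n : (1 <= n)%N ->
  let d eps t := chi2_dist gamma eps (l eps) (psi eps) n t 0 in
  let E := nonvanishing_indices (psi 1) n in
  (E = [::] -> forall eps t : R, 0 < eps -> eps <= 1 -> 0 <= t -> d eps t = 0) /\
  (E <> [::] ->
     let m := (\max_(j <- E) j)%N in
     let is_time (eps t : R) :=
       expR (- 2 * l 1 m * eps `^ ((gamma - 1) / (1 + gamma)) * t)
         * initial_coef gamma eps 0 (psi eps m) ^+ 2 = 1 in
     [/\ \forall eps \near 0^'+, exists2 t : R, 0 <= t & unique (is_time eps) t,
         exists2 C : R, 1 <= C & \forall eps \near 0^'+, forall t : R,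
           is_time eps t -> C^-1 <= d eps t <= C &
         exists2 C : R, 1 <= C & \forall eps \near 0^'+, forall t : R,
           is_time eps t ->
           eps `^ ((1 - gamma) / (1 + gamma)) / l 1 m
             * (gamma * (1 - gamma) / (1 + gamma) * ln eps - ln C)
             + 1 / (1 - gamma) * eps `^ ((gamma - 1) ^+ 2 / (gamma + 1)) <= t
           <= eps `^ ((1 - gamma) / (1 + gamma)) / l 1 m
             * (gamma * (1 - gamma) / (1 + gamma) * ln eps + ln C)
             + 1 / (1 - gamma) * eps `^ ((gamma - 1) ^+ 2 / (gamma + 1))]).
Proof.
move=> n1 d E; split=> [E0 eps t e0 e1 _|E0 m is_time].
  rewrite /d chi2_dist_zoom// big_nat big1 ?sqrtr0// => k kn.
  have u0 : psi 1 k 0 = 0.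
    apply/eqP; apply/negPn/negP => u0.
    have : k \in E by apply/nonvanishing_indicesP.
    by rewrite E0.
  by rewrite initial_coef_center_eq0// expr0n mulr0.
have /nonvanishing_indicesP[mn um] := bigmax_mem E0; rewrite -/m in mn um.
have m1 : (1 <= m)%N by case/andP: mn.
have is_timeE eps t : is_time eps t =
    (expR (- 2 * (l 1 m / Defs.radius gamma eps) * t)
      * initial_coef gamma eps 0 (psi eps m) ^+ 2 = 1).
  by rewrite /is_time radiusV !mulrA.
pose q k eps := initial_coef gamma eps 0 (psi eps k).
pose g eps := gamma * (1 - gamma) / (1 + gamma) * ln eps.
pose Z eps := (zoom eps `^ gamma) `^ (1 - gamma) / (1 - gamma).
have qm := initial_coef_center m1 um.
have gr M := growth_center M m1.
have qk k : (1 <= k <= n)%N -> (\forall eps \near 0^'+, q k eps = 0) \/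
    exists2 B, 0 < B & \forall eps \near 0^'+,
      (1 - l 1 k / l 1 m) * g eps <= 0 /\ `|q k eps| <= B * expR (g eps + l 1 k * Z eps).
  move=> kn; have k1 : (1 <= k)%N by case/andP: kn.
  have [u0|u0] := eqVneq (psi 1 k 0) 0.
    left; near=> eps; have [e0 e1] : 0 < eps /\ eps <= 1 by near: eps.
    exact: initial_coef_center_eq0.
  right; have [A [B [_ B0 AB]]] := initial_coef_center k1 u0.
  have km : (k <= m)%N.
    have kE : k \in E by apply/nonvanishing_indicesP.
    exact: (@leq_bigmax_seq _ _ xpredT id).
  have lkm : l 1 k <= l 1 m.
    move: km; rewrite leq_eqVlt => /predU1P[->//|km].
    by have [[_ _ li] _ _ _ _] := spec1; exact/ltW/li.
  exists B => //; near=> eps; split; last first.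
    by have /andP[] : A * expR (g eps + l 1 k * Z eps) <= `|q k eps|
      <= B * expR (g eps + l 1 k * Z eps) by near: eps.
  have [e0 e1] : 0 < eps /\ eps <= 1 by near: eps.
  rewrite mulr_ge0_le0// ?subr_ge0 ?ler_pdivrMr ?mul1r ?eigenvalue_gt0//.
  apply: mulr_ge0_le0; last exact: ln_le0.
  apply: divr_ge0; last by rewrite addr_ge0// ltW.
  by rewrite mulr_ge0 ?subr_ge0 ?(ltW gamma_gt0) ?(ltW gamma_lt1).
split.
- have := decay_time_exists_unique (q := q) (g := g) (Z := Z)
    (r := Defs.radius gamma) mn eigenvalue_gt0 near0_radius_gt0 gr qm.
  apply: filterS => eps [t t0 [tE tu]]; exists t => //; rewrite /unique is_timeE.
  by split=> // s; rewrite is_timeE; exact: tu.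
- have [C C1 hC] := dist_at_decay_time (q := q) (g := g) (Z := Z)
    (r := Defs.radius gamma) mn eigenvalue_gt0 near0_radius_gt0 qm qk.
  exists C => //; near=> eps => t; rewrite is_timeE.
  have [e0 e1] : 0 < eps /\ eps <= 1 by near: eps.
  by rewrite /d (chi2_dist_zoom n t 0 e0 e1); move: t; near: eps.
- have [C C1 hC] := decay_time_asymptotics (q := q) (g := g) (Z := Z)
    (r := Defs.radius gamma) mn eigenvalue_gt0 near0_radius_gt0 qm.
  exists C => //; near=> eps => t; rewrite is_timeE.
  have [e0 e1] : 0 < eps /\ eps <= 1 by near: eps.
  have -> : 1 / (1 - gamma) * eps `^ ((gamma - 1) ^+ 2 / (gamma + 1)) =
      Defs.radius gamma eps * Z eps.
    rewrite /Z mulrA -2!powRrM -powRD; last by rewrite (gt_eqF e0) implybT.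
    rewrite mul1r mulrC; congr (_ `^ _ * _); field.
    exact: gamma1_neq0.
  by move: t; near: eps.
Unshelve. all: by end_near. Qed.

End SmallNoise.

Theorem lemma2p7 (R : realType) (gamma : R)
    (l : R -> nat -> R) (psi : R -> nat -> R -> R)
    (hgamma : 1 / 3 < gamma) (hgamma1 : gamma < 1)
    (hspec : forall eps : R, 0 < eps -> eps <= 1 ->
       spectral_system gamma eps (l eps) (psi eps)) :
  let d (n : nat) (eps t x0 : R) :=
    chi2_dist gamma eps (l eps) (psi eps) n t x0 in
  (forall x0 : R, x0 != 0 ->
    [/\ \forall eps \near 0^'+,
          exists2 t : R, 0 <= t & unique (fun s : R => d 1%N eps s x0 = 1) t,
        forall n : nat, (1 <= n)%N ->
          exists2 C : R, 1 <= C & \forall eps \near 0^'+, forall t : R,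
            d 1%N eps t x0 = 1 -> C^-1 <= d n eps t x0 <= C &
        exists2 C : R, 1 <= C & \forall eps \near 0^'+, forall t : R,
          d 1%N eps t x0 = 1 ->
          ln (1 / C) / l 1 1%N * eps `^ ((1 - gamma) / (1 + gamma))
            + `|x0| `^ (1 - gamma) / (1 - gamma) <= t
          <= ln C / l 1 1%N * eps `^ ((1 - gamma) / (1 + gamma))
            + `|x0| `^ (1 - gamma) / (1 - gamma)])
  /\
  (forall n : nat, (1 <= n)%N ->
    let E := nonvanishing_indices (psi 1) n in
    (E = [::] -> forall eps t : R, 0 < eps -> eps <= 1 -> 0 <= t ->
       d n eps t 0 = 0) /\
    (E <> [::] ->
       let m := (\max_(j <- E) j)%N in
       let is_time (eps t : R) :=
         expR (- 2 * l 1 m * eps `^ ((gamma - 1) / (1 + gamma)) * t)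
           * initial_coef gamma eps 0 (psi eps m) ^+ 2 = 1 in
       [/\ \forall eps \near 0^'+, exists2 t : R, 0 <= t & unique (is_time eps) t,
           exists2 C : R, 1 <= C & \forall eps \near 0^'+, forall t : R,
             is_time eps t -> C^-1 <= d n eps t 0 <= C &
           exists2 C : R, 1 <= C & \forall eps \near 0^'+, forall t : R,
             is_time eps t ->
             eps `^ ((1 - gamma) / (1 + gamma)) / l 1 m
               * (gamma * (1 - gamma) / (1 + gamma) * ln eps - ln C)
               + 1 / (1 - gamma) * eps `^ ((gamma - 1) ^+ 2 / (gamma + 1)) <= t
             <= eps `^ ((1 - gamma) / (1 + gamma)) / l 1 m
               * (gamma * (1 - gamma) / (1 + gamma) * ln eps + ln C)
               + 1 / (1 - gamma) * eps `^ ((gamma - 1) ^+ 2 / (gamma + 1))])).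
Proof.
move=> d; split=> [x0 x00|n n1].
  exact: (relaxation_away hgamma hgamma1 hspec x00).
exact: (relaxation_center hgamma hgamma1 hspec n1).
Qed.
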